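(* Let $\zeta$ be the Riemann zeta-function and $G(s)=\frac{1}{(s-1)\zeta(s)}$. Let $g:[0,\infty)\to\mathbb{R}$ be the impulse response of $G$, i.e. the inverse Laplace transform $g=\mathcal{L}^{-1}\{G\}$, given for $0<t<\ln(N+1)$ (any integer $N\ge1$) by $$g(t)=\sum_{k=0}^{\infty}\sum_{n=0}^{k}(-1)^n\binom{k}{n}\sum_{m=1}^{N}d_n(m)\,h(t-\ln m)\,L_n(t-\ln m).$$ Suppose that (growth conjecture) there is $k\in\{0,1,2\}$ such that $g(t)=O(t^k e^{t/2})$ as $t\to\infty$. Then the Riemann hypothesis holds: every complex (non-trivial) zero of $\zeta$ has the form $\tfrac12\pm i\gamma$ with $\gamma\in\mathbb{R}$.
   Context: $h$ is the unit step function ($h(t)=0$ for $t<0$, $h(0)=\tfrac12$, $h(t)=1$ for $t>0$); $L_n(t)=\sum_{\nu=0}^{n}\binom{n}{\nu}\frac{(-t)^{\nu}}{\nu!}$ is the $n$-th Laguerre polynomial; for $n\ge1$, $d_n(m)$ is the Piltz divisor function (number of ordered $n$-tuples of positive integers with product $m$), and $d_0$ denotes the coefficients of $\zeta(s)^0=1$. $g$ is assumed to be a function whose Laplace transform $\int_0^\infty e^{-st}g(t)\,dt$ equals $G(s)$ on a right half-plane. *)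

(* Defs.v *)
From mathcomp Require Import ssreflect ssrfun ssrbool eqtype ssrnat seq
  fintype tuple bigop finset.
From Stdlib Require Import Reals.
From Coquelicot Require Import Coquelicot.

Set Implicit Arguments.
Unset Strict Implicit.

(* Piltz divisor function: number of ordered n-tuples (a_1,...,a_n) of
   positive integers with a_1 * ... * a_n = m.  Entries are drawn from
   {0,...,m}; any tuple with product m >= 1 has all entries in {1..m}.
   For n = 0 the only (empty) tuple has product 1, so piltz 0 m = [m == 1],
   i.e. the coefficients of zeta(s)^0 = 1. *)
Definition piltz (n m : nat) : nat :=
  #|[set t : n.-tuple 'I_m.+1 | (\prod_(i <- t) (nat_of_ord i) == m)%N]|.

Open Scope R_scope.

Definition h (t : R) : R :=
  if Rlt_dec t 0 then 0 else if Rlt_dec 0 t then 1 else / 2.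

Definition laguerre (n : nat) (t : R) : R :=
  sum_f_R0 (fun nu => Binomial.C n nu * (- t) ^ nu / INR (Factorial.fact nu)) n.

Definition g_term (N : nat) (t : R) (k : nat) : R :=
  sum_f_R0 (fun n => (-1) ^ n * Binomial.C k n *
     sum_f 1 N (fun m => INR (piltz n m) * h (t - ln (INR m))
                          * laguerre n (t - ln (INR m)))) k.

Definition npow_neg (n : nat) (s : C) : C :=
  (exp (- Re s * ln (INR n)) * cos (Im s * ln (INR n)),
   - (exp (- Re s * ln (INR n)) * sin (Im s * ln (INR n)))).

Definition two_pow_1ms (s : C) : C :=
  (exp ((1 - Re s) * ln 2) * cos (Im s * ln 2),
   - (exp ((1 - Re s) * ln 2) * sin (Im s * ln 2))).

Definition eta_partial (s : C) (N : nat) : C :=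
  (sum_f 1 N (fun n => (-1) ^ (n - 1) * Re (npow_neg n s)),
   sum_f 1 N (fun n => (-1) ^ (n - 1) * Im (npow_neg n s))).

(* Dirichlet eta function (the series converges for Re s > 0) *)
Definition eta (s : C) : C :=
  (real (Lim_seq (fun N => fst (eta_partial s N))),
   real (Lim_seq (fun N => snd (eta_partial s N)))).

(* Riemann zeta function on the half-plane Re s > 0 (via its standard
   continuation zeta(s) = eta(s) / (1 - 2^{1-s})).  This is the genuine
   zeta function whenever Re s > 0 and Re s <> 1 (there 1 - 2^{1-s} <> 0);
   in particular on the critical strip and on Re s > 1. *)
Definition zeta (s : C) : C := Cdiv (eta s) (Cminus 1 (two_pow_1ms s)).

Definition G (s : C) : C := Cinv (Cmult (Cminus s 1) (zeta s)).

Definition laplace_eq_on_half_plane (g : R -> R) (F : C -> C) : Prop :=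
  exists sigma0 : R, forall sigma tau : R, sigma0 < sigma ->
    is_RInt_gen (fun t => exp (- sigma * t) * cos (tau * t) * g t)
       (at_point 0) (Rbar_locally p_infty) (Re (F (sigma, tau))) /\
    is_RInt_gen (fun t => - (exp (- sigma * t) * sin (tau * t) * g t))
       (at_point 0) (Rbar_locally p_infty) (Im (F (sigma, tau))).

Definition RH : Prop :=
  forall s : C, 0 < Re s < 1 -> zeta s = 0 -> Re s = / 2.

(* Main.v *)
Require Import Defs.
From Stdlib Require Import Reals Lra Lia Factorial ClassicalEpsilon.
From Coquelicot Require Import Coquelicot.
Open Scope R_scope.

(** The bound on [g] makes its Laplace transform [L g] converge for [Re s > 1/2], so
    the identity [L g s * (s - 1) * zeta s = 1], known far to the right, continues
    to [Re s > 1/2] and excludes zeros there; on each horizontal line the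
    continuation is an identity of power series in [Re s] about one far centre,
    whose disc reaches down to abscissa [1/2].  Zeros with [Re s < 1/2] are moved
    to [Re s > 1/2] by a functional equation.  The 4-periodic sequence
    [a = 1, -2, 1, 0] satisfies [sum a_k k^-s = (1 - 2^-s) eta s], and summing
    twice by parts this is [s (s + 1)] times the Mellin transform of the
    4-periodic tent function [T].  The sequence is its own discrete Fourier
    transform up to a factor:
    [T x = 4 / pi^2 * sum a_k (1 - cos (k pi x / 2)) / k^2].  Integrating this
    against [x^(-s-2)] turns the transform at [s] into a multiple of
    [sum a_k k^(s-1)], so it vanishes as soon as [eta (1 - s) = 0]. *)

(** * Integrals over the whole line *)

(* Equalities stated in a Coquelicot structure on R block [ring] and [field]. *)
Ltac eq_R := match goal with |- @eq _ ?a ?b => change (@eq R a b) end.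

(** Everything is arranged so that only vanishing has to be tracked. Since the sequence is its own
    dual, one and the same function [tent] occurs in the summation by parts and in the Fourier
    series, and the Gamma factor of the classical functional equation survives only as an integral
    that is never evaluated: it multiplies a limit equal to 0. The plain alternating sequence would
    not do, because its dual lives on the odd integers. Two summations by parts, rather than one,
    produce the weights 1/k^2 that make the Fourier series converge uniformly. The obstacle left is
    the singularity of x^(-s-2) at 0, against which a uniform error is not integrable; a bound x^2
    that holds for all partial sums at once overcomes it. The continuation is done for a product
    without denominators: L g s (s - 1) s (s + 1) times the Mellin transform of T equals (1 -
    2^(1-s)) (1 - 2^(-s)). So the target in both cases, a zero right or left of the critical line,
    is the same contradiction: a zero of the transform of T with 1/2 < Re s < 1. *)

Lemma step_approx_mult (f w : R -> R) (a b : R) :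
  ex_RInt f a b -> (forall x, a <= x <= b -> continuous w x) ->
  forall (eps : posreal) (x : R), a <= x <= b ->
  exists v : R -> R, ex_RInt v a x /\
    forall t, a <= t <= x -> Rabs (v t - w t * f t) <= eps.
Proof.
intros Hf Hw eps.
destruct (Rle_dec a b) as [Hab|Hab]; [|intros x Hx; lra].
destruct (ex_RInt_ub f a b Hf) as [K0 HK0].
rewrite (Rmin_left _ _ Hab), (Rmax_right _ _ Hab) in HK0.
set (K := Rmax K0 1).
assert (HK : 0 < K) by (unfold K; pose proof (Rmax_r K0 1); lra).
assert (HKf : forall t, a <= t <= b -> Rabs (f t) <= K).
{ intros t Ht; apply Rle_trans with K0; [exact (HK0 t Ht) | apply Rmax_l]. }
assert (He : 0 < eps / K) by (apply Rdiv_lt_0_compat; [apply cond_pos | exact HK]).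
destruct (unifcont_1d w a b Hw (mkposreal _ He)) as [d Hd].
assert (Hdp := cond_pos d).
assert (Hw' : forall s t, a <= s <= b -> a <= t <= b -> Rabs (t - s) < d ->
   Rabs (w t - w s) <= eps / K).
{ intros s t Hs Ht Hst.
  destruct (Rle_dec (Rabs (w t - w s)) (eps / K)) as [H|H]; [exact H|].
  exfalso; apply (Hd s t Hs Ht Hst); intros Hb; apply H.
  apply Rlt_le; exact Hb. }
(* On a piece of length at most [d / 2], replacing [w] by its value at the left end [m] changes the
   product by at most [eps], and a constant multiple of [f] is integrable. The induction counts the
   pieces. *)
assert (HI : forall n x, a <= x <= b -> x <= a + INR n * (d / 2) ->
  exists v : R -> R, ex_RInt v a x /\
    forall t, a <= t <= x -> Rabs (v t - w t * f t) <= eps).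
{ assert (Hep := cond_pos eps).
  induction n as [|n IH]; intros x Hx Hxn.
  - assert (x = a) by (simpl in Hxn; lra); subst x.
    exists (fun t => w t * f t); split; [apply ex_RInt_point|].
    intros t _; rewrite Rminus_diag, Rabs_R0; lra.
  - rewrite S_INR in Hxn.
    set (m := Rmax a (x - d / 2)).
    assert (Hm : a <= m <= x).
    { unfold m; split; [apply Rmax_l | apply Rmax_lub; lra]. }
    assert (Hm' : x - d / 2 <= m) by apply Rmax_r.
    assert (Hm2 : m <= a + INR n * (d / 2)).
    { unfold m; apply Rmax_lub; [|lra].
      pose proof (Rmult_le_pos _ (d / 2) (pos_INR n) ltac:(lra)); lra. }
    destruct (IH m ltac:(lra) Hm2) as [v [Hv1 Hv2]].
    exists (fun t => if Rle_dec t m then v t else w m * f t); split.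
    + apply ex_RInt_Chasles with m.
      * apply ex_RInt_ext with v; [|exact Hv1].
        rewrite (Rmin_left _ _ (proj1 Hm)), (Rmax_right _ _ (proj1 Hm)).
        intros t Ht; destruct (Rle_dec t m); [reflexivity | lra].
      * apply ex_RInt_ext with (fun t => scal (w m) (f t)).
        { rewrite (Rmin_left _ _ (proj2 Hm)), (Rmax_right _ _ (proj2 Hm)).
          intros t Ht; destruct (Rle_dec t m); [lra | reflexivity]. }
        apply (ex_RInt_scal f m x (w m)).
        apply (ex_RInt_Chasles_1 (V := R_CompleteNormedModule)) with b; [lra|].
        apply (ex_RInt_Chasles_2 (V := R_CompleteNormedModule)) with a; [lra | exact Hf].
    + intros t Ht; destruct (Rle_dec t m) as [Htm|Htm]; [apply Hv2; lra|].
      replace (w m * f t - w t * f t) with ((w m - w t) * f t) by ring.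
      rewrite Rabs_mult.
      replace (pos eps) with (eps / K * K) by (field; lra).
      apply Rmult_le_compat; try apply Rabs_pos; [|apply HKf; lra].
      apply Hw'; try lra; rewrite Rabs_left1; lra. }
intros x Hx.
destruct (INR_unbounded ((x - a) / (d / 2))) as [n Hn].
apply (HI n x Hx).
apply (Rmult_lt_compat_r (d / 2)) in Hn; [|lra].
replace ((x - a) / (d / 2) * (d / 2)) with (x - a) in Hn by (field; lra).
lra.
Qed.

(** Of [g] nothing is known but that certain Laplace integrals exist, so integrability of products
    cannot come from continuity. Here the product is a uniform limit of functions that are piecewise
    constant multiples of [f]. *)
Lemma ex_RInt_mult_continuous (f w : R -> R) (a b : R) :
  a <= b -> ex_RInt f a b -> (forall x, a <= x <= b -> continuous w x) ->
  ex_RInt (fun t => w t * f t) a b.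
Proof.
intros Hab Hf Hw.
assert (HA := fun n : nat =>
  step_approx_mult f w a b Hf Hw (mkposreal _ (RinvN_pos n)) b ltac:(lra)).
set (v := fun n => proj1_sig (constructive_indefinite_description _ (HA n))).
assert (Hv : forall n, ex_RInt (v n) a b /\
    forall t, a <= t <= b -> Rabs (v n t - w t * f t) <= / (INR n + 1)).
{ intros n; exact (proj2_sig (constructive_indefinite_description _ (HA n))). }
(* Uniform convergence is required on the whole line, so outside [[a, b]] the approximation is set
   equal to its limit. *)
set (v' := fun n t => match Rle_dec a t, Rle_dec t b with
   | left _, left _ => v n t | _, _ => w t * f t end).
assert (Hv' : forall n, is_RInt (v' n) a b (RInt (v n) a b)).
{ intros n; apply is_RInt_ext with (v n); [|apply (RInt_correct (V := R_CompleteNormedModule)), Hv].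
  rewrite (Rmin_left _ _ Hab), (Rmax_right _ _ Hab); intros t Ht.
  unfold v'; destruct (Rle_dec a t), (Rle_dec t b); try reflexivity; lra. }
assert (Hl : filterlim v' eventually
   (locally (fun t => w t * f t : R_CompleteNormedModule))).
{ apply (proj2 (filterlim_locally (U := fct_UniformSpace R R_CompleteNormedModule)
     v' (fun t => w t * f t))).
  intros eps.
  destruct (archimed_cor1 eps (cond_pos eps)) as [N [HN HN0]].
  exists N; intros n Hn t.
  apply Rle_lt_trans with (/ (INR n + 1)).
  - change (Rabs (v' n t - w t * f t) <= / (INR n + 1)).
    unfold v'; destruct (Rle_dec a t), (Rle_dec t b);
      try (rewrite Rminus_diag, Rabs_R0; apply Rlt_le, RinvN_pos).
    apply Hv; lra.
  - apply Rle_lt_trans with (/ INR N); [|exact HN].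
    apply Rinv_le_contravar; [apply lt_0_INR; lia|].
    apply le_INR in Hn; lra. }
destruct (filterlim_RInt v' a b eventually _ (fun t => w t * f t) _ Hv' Hl)
  as [I [_ HI]].
exists I; exact HI.
Qed.

Lemma ex_RInt_mult_continuous_everywhere (f w : R -> R) :
  (forall x y, ex_RInt f x y) -> (forall t, continuous w t) ->
  forall x y, ex_RInt (fun t => w t * f t) x y.
Proof.
intros Hf Hw x y; destruct (Rle_dec x y).
- apply ex_RInt_mult_continuous; auto.
- apply ex_RInt_swap, ex_RInt_mult_continuous; auto; lra.
Qed.

(** The rate [c] may have either sign: for [c < 0] the quotient and the difference in the bound both
    change sign. One statement thus serves the tails at both ends of the line. *)
Lemma norm_RInt_exp_le (f : R -> R) (M c x y : R) :
  0 < Rabs c -> x <= y -> ex_RInt f x y ->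
  (forall t, x <= t <= y -> Rabs (f t) <= M * exp (c * t)) ->
  Rabs (RInt f x y) <= M / c * (exp (c * y) - exp (c * x)).
Proof.
intros Hc Hxy Hf Hb.
assert (Hc0 : c <> 0) by (intros ->; rewrite Rabs_R0 in Hc; lra).
refine (norm_RInt_le f (fun t => M * exp (c * t)) x y (RInt f x y) _ Hxy Hb
  (RInt_correct (V := R_CompleteNormedModule) _ _ _ Hf) _).
replace (M / c * (exp (c * y) - exp (c * x)))
  with (minus (M / c * exp (c * y)) (M / c * exp (c * x)))
  by (unfold minus, plus, opp; simpl; ring).
apply (is_RInt_derive (fun t => M / c * exp (c * t))).
- intros t _; auto_derive; [exact I | field; exact Hc0].
- intros t _; apply (ex_derive_continuous (V := R_NormedModule)); auto_derive; exact I.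
Qed.

(** With x = e^t a Mellin transform over (0, infinity) becomes an integral over the whole line, a
    dilation of x becomes a translation of t, and a Laplace transform is the case of a function
    vanishing for t < 0. *)
Notation is_RInt_line f I :=
  (is_RInt_gen f (Rbar_locally m_infty) (Rbar_locally p_infty) I).

Lemma line_filter_below_above (A B : R) :
  filter_prod (Rbar_locally m_infty) (Rbar_locally p_infty)
    (fun ab : R * R => fst ab < A /\ B < snd ab).
Proof.
exists (fun x => x < A) (fun y => B < y).
- exists A; intros x Hx; exact Hx.
- exists B; intros x Hx; exact Hx.
- intros x y Hx Hy; split; assumption.
Qed.

Lemma exp_le_of_le (x y : R) : x <= y -> exp x <= exp y.
Proof. intros [Hxy | ->]; [apply Rlt_le, exp_increasing, Hxy | apply Rle_refl]. Qed.

Lemma exp_linear_lt (c M : R) (eps : R) : 0 < c -> 0 <= M -> 0 < eps ->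
  exists B, 0 <= B /\ forall t, t <= - B -> M * exp (c * t) < eps.
Proof.
intros Hc HM He.
exists (Rmax 0 (- ln (eps / (M + 1)) / c)); split; [apply Rmax_l|].
intros t Ht.
pose proof (Rmax_r 0 (- ln (eps / (M + 1)) / c)) as H.
assert (Hct : c * t <= ln (eps / (M + 1))).
{ assert (c * (- ln (eps / (M + 1)) / c) = - ln (eps / (M + 1))) by (field; lra).
  nra. }
assert (Hp : 0 < eps / (M + 1)) by (apply Rdiv_lt_0_compat; lra).
assert (He2 : exp (c * t) <= eps / (M + 1)).
{ rewrite <- (exp_ln (eps / (M + 1))) by exact Hp.
  apply exp_le_of_le, Hct. }
apply Rle_lt_trans with (M * (eps / (M + 1))).
- apply Rmult_le_compat_l; assumption.
- apply Rmult_lt_reg_r with (M + 1); [lra|].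
  replace (M * (eps / (M + 1)) * (M + 1)) with (M * eps) by (field; lra).
  nra.
Qed.

(** The tails are exponentially small, so the integrals over [[x, y]] satisfy the Cauchy criterion.
    The explicit bound matters as much as existence: later the constants and [t0] vary, and the
    bound forces differences of integrals to 0. *)
Lemma is_RInt_line_exp_dom (f : R -> R) (M1 M2 a b t0 : R) :
  0 < a -> 0 < b -> 0 <= M1 -> 0 <= M2 ->
  (forall x y, ex_RInt f x y) ->
  (forall t, t <= t0 -> Rabs (f t) <= M1 * exp (a * t)) ->
  (forall t, t0 <= t -> Rabs (f t) <= M2 * exp (- b * t)) ->
  exists I, is_RInt_line f I /\
    Rabs I <= M1 / a * exp (a * t0) + M2 / b * exp (- b * t0).
Proof.
intros Ha Hb HM1 HM2 Hf H1 H2.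
assert (Hpa : 0 <= M1 / a) by (apply Rdiv_le_0_compat; lra).
assert (Hpb : 0 <= M2 / b) by (apply Rdiv_le_0_compat; lra).
assert (Hlow : forall x y, x <= t0 -> y <= t0 ->
  Rabs (RInt f x y) <= M1 / a * exp (a * Rmax x y)).
{ assert (Hlow0 : forall x y, x <= y -> y <= t0 ->
    Rabs (RInt f x y) <= M1 / a * exp (a * y)).
  { intros x y Hxy Hy.
    eapply Rle_trans; [apply (norm_RInt_exp_le f M1 a); auto|].
    - rewrite Rabs_right; lra.
    - intros t Ht; apply H1; lra.
    - pose proof (exp_pos (a * x)); nra. }
  intros x y Hx Hy; destruct (Rle_dec x y) as [Hxy|Hxy].
  - rewrite Rmax_right by exact Hxy; apply Hlow0; assumption.
  - rewrite Rmax_left by lra.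
    rewrite <- opp_RInt_swap by apply Hf.
    unfold opp; simpl; rewrite Rabs_Ropp; apply Hlow0; lra. }
assert (Hup : forall x y, t0 <= x -> t0 <= y ->
  Rabs (RInt f x y) <= M2 / b * exp (- b * Rmin x y)).
{ assert (Hup0 : forall x y, x <= y -> t0 <= x ->
    Rabs (RInt f x y) <= M2 / b * exp (- b * x)).
  { intros x y Hxy Hx.
    eapply Rle_trans; [apply (norm_RInt_exp_le f M2 (- b)); auto|].
    - rewrite Rabs_left; lra.
    - intros t Ht; apply H2; lra.
    - pose proof (exp_pos (- b * y)).
      replace (M2 / - b) with (- (M2 / b)) by (field; lra); nra. }
  intros x y Hx Hy; destruct (Rle_dec x y) as [Hxy|Hxy].
  - rewrite Rmin_left by exact Hxy; apply Hup0; assumption.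
  - rewrite Rmin_right by lra.
    rewrite <- opp_RInt_swap by apply Hf.
    unfold opp; simpl; rewrite Rabs_Ropp; apply Hup0; lra. }
destruct (proj1 (filterlim_locally_cauchy (U := R_CompleteSpace)
  (F := filter_prod (Rbar_locally m_infty) (Rbar_locally p_infty))
  (fun ab : R * R => RInt f (fst ab) (snd ab)))) as [I HI].
{ intros eps.
  assert (He : 0 < eps / 2) by (pose proof (cond_pos eps); lra).
  destruct (exp_linear_lt a (M1 / a) _ Ha Hpa He) as [B1 [HB10 HB1]].
  destruct (exp_linear_lt b (M2 / b) _ Hb Hpb He) as [B2 [HB20 HB2]].
  exists (fun ab : R * R => fst ab < Rmin t0 (- B1) /\ Rmax t0 B2 < snd ab).
  split; [apply line_filter_below_above|].
  intros [x y] [x' y']; simpl; intros [Hx Hy] [Hx' Hy'].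
  pose proof (Rmin_l t0 (- B1)); pose proof (Rmin_r t0 (- B1)).
  pose proof (Rmax_l t0 B2); pose proof (Rmax_r t0 B2).
  change (Rabs (RInt f x' y' - RInt f x y) < eps).
  replace (RInt f x' y' - RInt f x y) with (RInt f x' x + RInt f y y').
  2:{ rewrite <- (RInt_Chasles f x' x y'), <- (RInt_Chasles f x y y') by apply Hf.
      unfold plus; simpl; ring. }
  eapply Rle_lt_trans; [apply Rabs_triang|].
  apply Rle_lt_trans with (M1 / a * exp (a * Rmax x' x) + M2 / b * exp (- b * Rmin y y')).
  { apply Rplus_le_compat; [apply Hlow | apply Hup]; lra. }
  assert (M1 / a * exp (a * Rmax x' x) < eps / 2).
  { apply HB1, Rmax_lub; lra. }
  assert (M2 / b * exp (- b * Rmin y y') < eps / 2).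
  { replace (- b * Rmin y y') with (b * - Rmin y y') by ring.
    apply HB2, Ropp_le_contravar, Rmin_glb; lra. }
  lra. }
assert (HIf : is_RInt_line f I).
{ intros P HP; unfold filtermapi.
  apply filter_imp with (fun ab : R * R => P (RInt f (fst ab) (snd ab))).
  - intros [x y] Hxy; exists (RInt f x y); split; [apply (RInt_correct (V := R_CompleteNormedModule)), Hf | exact Hxy].
  - apply HI; exact HP. }
exists I; split; [exact HIf|].
apply (filterlim_le (F := filter_prod (Rbar_locally m_infty) (Rbar_locally p_infty))
  (fun ab : R * R => Rabs (RInt f (fst ab) (snd ab)))
  (fun _ => M1 / a * exp (a * t0) + M2 / b * exp (- b * t0))
  (Finite (Rabs I)) (Finite (M1 / a * exp (a * t0) + M2 / b * exp (- b * t0)))).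
- apply filter_imp with (2 := line_filter_below_above t0 t0).
  intros [x y]; simpl; intros [Hx Hy].
  rewrite <- (RInt_Chasles f x t0 y) by apply Hf.
  eapply Rle_trans; [apply Rabs_triang|].
  apply Rplus_le_compat.
  + rewrite <- (Rmax_right x t0) at 2 by lra; apply Hlow; lra.
  + rewrite <- (Rmin_left t0 y) at 2 by lra; apply Hup; lra.
- apply (filterlim_comp _ _ _ (fun ab : R * R => RInt f (fst ab) (snd ab)) Rabs _
   (locally I) (Rbar_locally (Rabs I))); [exact HI|].
  apply (continuous_Rabs I).
- apply filterlim_const.
Qed.

Lemma is_RInt_line_shift (f : R -> R) (v I : R) :
  is_RInt_line f I -> is_RInt_line (fun t => f (t + v)) I.
Proof.
intros Hf P HP; destruct (Hf P HP) as [Q1 Q2 [B1 HB1] [B2 HB2] H].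
exists (fun x => x < B1 - v) (fun y => B2 - v < y).
- exists (B1 - v); intros x Hx; exact Hx.
- exists (B2 - v); intros x Hx; exact Hx.
- intros x y Hx Hy.
  destruct (H (x + v) (y + v)) as [z [Hz HPz]].
  + apply HB1; lra.
  + apply HB2; lra.
  + exists z; split; [|exact HPz]; simpl in Hz |- *.
    apply is_RInt_ext with (fun t => scal 1 (f (1 * t + v))).
    * intros t _; rewrite (Rmult_1_l t); apply Rmult_1_l.
    * apply (is_RInt_comp_lin f 1 v x y z).
      replace (1 * x + v) with (x + v) by ring.
      replace (1 * y + v) with (y + v) by ring.
      exact Hz.
Qed.

Lemma is_RInt_line_plus (f g : R -> R) (I J : R) :
  is_RInt_line f I -> is_RInt_line g J ->
  is_RInt_line (fun t => f t + g t) (I + J).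
Proof. intros Hf Hg; exact (is_RInt_gen_plus f g I J Hf Hg). Qed.

Lemma is_RInt_line_scal (f : R -> R) (k I : R) :
  is_RInt_line f I -> is_RInt_line (fun t => k * f t) (k * I).
Proof. intros Hf; exact (is_RInt_gen_scal f k I Hf). Qed.

Lemma is_RInt_line_ext (f g : R -> R) (I : R) :
  (forall t, f t = g t) -> is_RInt_line f I -> is_RInt_line g I.
Proof.
intros Hfg; apply is_RInt_gen_ext, filter_forall; intros ab t _; apply Hfg.
Qed.

Lemma is_RInt_line_unique (f : R -> R) (I J : R) :
  is_RInt_line f I -> is_RInt_line f J -> I = J.
Proof.
intros HI HJ.
rewrite <- (is_RInt_gen_unique f I HI); exact (is_RInt_gen_unique f J HJ).
Qed.

Lemma is_RInt_zero (a b : R) : is_RInt (fun _ => 0) a b 0.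
Proof.
pose proof (is_RInt_const (V := R_NormedModule) a b 0) as H.
change (scal (b - a) 0) with ((b - a) * 0) in H; rewrite Rmult_0_r in H; exact H.
Qed.

Lemma is_RInt_line_sum_n (f : nat -> R -> R) (I : nat -> R) (n : nat) :
  (forall k, is_RInt_line (f k) (I k)) ->
  is_RInt_line (fun t => sum_n (fun k => f k t) n) (sum_n I n).
Proof.
intros Hf; induction n as [|n IH].
- apply is_RInt_line_ext with (f 0%nat); [intros t; now rewrite sum_O|].
  rewrite sum_O; apply Hf.
- rewrite sum_Sn.
  apply is_RInt_line_ext with (fun t => sum_n (fun k => f k t) n + f (S n) t).
  + intros t; now rewrite sum_Sn.
  + apply is_RInt_line_plus; [exact IH | apply Hf].
Qed.

Lemma is_RInt_line_half (f : R -> R) (I : R) :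
  is_RInt_gen f (at_point 0) (Rbar_locally p_infty) I ->
  is_RInt_line (fun t => if Rlt_dec t 0 then 0 else f t) I.
Proof.
intros Hf; rewrite <- (Rplus_0_l I).
apply (is_RInt_gen_Chasles (fun t => if Rlt_dec t 0 then 0 else f t) 0).
- intros P HP.
  exists (fun x => x < 0) (fun y => y = 0).
  + exists 0; intros x Hx; exact Hx.
  + reflexivity.
  + intros x y Hx ->; exists 0; split; [|apply locally_singleton, HP]; simpl.
    apply is_RInt_ext with (fun _ => 0).
    * rewrite Rmin_left, Rmax_right by lra; intros t Ht.
      destruct (Rlt_dec t 0); [reflexivity | lra].
    * apply is_RInt_zero.
- apply is_RInt_gen_ext with (2 := Hf).
  exists (fun x => x = 0) (fun y => 0 < y).
  + reflexivity.
  + exists 0; intros x Hx; exact Hx.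
  + intros x y -> Hy t; simpl; rewrite Rmin_left, Rmax_right by lra; intros Ht.
    destruct (Rlt_dec t 0); [lra | reflexivity].
Qed.

(** * Power series and Laplace transforms *)

Definition has_power_series (f : R -> R) (x0 r : R) : Prop :=
  exists a : nat -> R, forall u, Rabs u < r ->
    is_series (fun n => a n * u ^ n) (f (x0 + u)).

Lemma CV_radius_gt (a : nat -> R) (r u : R) :
  (forall v, Rabs v < r -> ex_series (fun n => a n * v ^ n)) ->
  Rabs u < r -> Rbar_lt (Rabs u) (CV_radius a).
Proof.
intros Ha Hu.
set (v := (Rabs u + r) / 2).
assert (Hv : Rabs v = v) by (apply Rabs_right; unfold v; pose proof (Rabs_pos u); lra).
destruct (Rbar_lt_dec (Rabs u) (CV_radius a)) as [H|H]; [exact H|].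
exfalso; apply Rbar_not_lt_le in H.
apply (CV_disk_outside a v).
- apply Rbar_le_lt_trans with (1 := H); rewrite Hv; simpl; unfold v; lra.
- apply ex_series_lim_0, Ha; rewrite Hv; unfold v; lra.
Qed.

Lemma has_power_series_mult (f g : R -> R) (x0 r : R) :
  has_power_series f x0 r -> has_power_series g x0 r ->
  has_power_series (fun x => f x * g x) x0 r.
Proof.
intros [a Ha] [b Hb]; exists (PS_mult a b); intros u Hu.
apply (proj1 (is_pseries_R (PS_mult a b) u (f (x0 + u) * g (x0 + u)))).
apply (is_pseries_mult a b u (f (x0 + u)) (g (x0 + u))).
- apply is_pseries_R, Ha, Hu.
- apply is_pseries_R, Hb, Hu.
- apply CV_radius_gt with r; [|exact Hu].
  intros v Hv; exists (f (x0 + v)); apply Ha, Hv.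
- apply CV_radius_gt with r; [|exact Hu].
  intros v Hv; exists (g (x0 + v)); apply Hb, Hv.
Qed.

Lemma has_power_series_plus (f g : R -> R) (x0 r : R) :
  has_power_series f x0 r -> has_power_series g x0 r ->
  has_power_series (fun x => f x + g x) x0 r.
Proof.
intros [a Ha] [b Hb]; exists (fun n => a n + b n); intros u Hu.
apply is_series_ext with (fun n => a n * u ^ n + b n * u ^ n).
- intros n; symmetry; apply Rmult_plus_distr_r.
- exact (is_series_plus _ _ _ _ (Ha u Hu) (Hb u Hu)).
Qed.

Lemma has_power_series_scal (f : R -> R) (k x0 r : R) :
  has_power_series f x0 r -> has_power_series (fun x => k * f x) x0 r.
Proof.
intros [a Ha]; exists (fun n => k * a n); intros u Hu.
apply is_series_ext with (fun n => k * (a n * u ^ n)).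
- intros n; symmetry; apply Rmult_assoc.
- exact (is_series_scal k _ _ (Ha u Hu)).
Qed.

Lemma has_power_series_ext (f g : R -> R) (x0 r : R) :
  (forall x, f x = g x) -> has_power_series f x0 r -> has_power_series g x0 r.
Proof. intros Hfg [a Ha]; exists a; intros u Hu; rewrite <- Hfg; apply Ha, Hu. Qed.

Lemma has_power_series_minus (f g : R -> R) (x0 r : R) :
  has_power_series f x0 r -> has_power_series g x0 r ->
  has_power_series (fun x => f x - g x) x0 r.
Proof.
intros Hf Hg; apply has_power_series_ext with (fun x => f x + (-1) * g x).
- intros x; ring.
- apply has_power_series_plus; [|apply has_power_series_scal]; assumption.
Qed.

Lemma has_power_series_affine (k l x0 r : R) :
  has_power_series (fun x => k * x + l) x0 r.
Proof.
exists (fun n => match n with O => k * x0 + l | S O => k | _ => 0 end); intros u _.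
apply (is_lim_seq_ext_loc (fun _ => k * (x0 + u) + l) _ (Finite (k * (x0 + u) + l))); [|apply is_lim_seq_const].
exists 1%nat; intros n Hn; destruct n as [|n]; [lia|]; clear Hn.
induction n as [|n IH].
- rewrite sum_Sn, sum_O; unfold plus; simpl; ring.
- rewrite sum_Sn, <- IH; unfold plus; simpl; ring.
Qed.

Lemma is_series_exp (z : R) : is_series (fun n => z ^ n / INR (fact n)) (exp z).
Proof.
apply is_series_ext with (2 := proj1 (is_pseries_R _ _ _) (is_exp_Reals z)).
intros n; apply Rmult_comm.
Qed.

Lemma has_power_series_exp (k x0 r : R) :
  has_power_series (fun x => exp (k * x)) x0 r.
Proof.
exists (fun n => exp (k * x0) * (k ^ n / INR (fact n))); intros u _.
replace (k * (x0 + u)) with (k * x0 + k * u) by ring; rewrite exp_plus.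
apply is_series_ext with (fun n => exp (k * x0) * ((k * u) ^ n / INR (fact n))).
- intros n; change (exp (k * x0) * ((k * u) ^ n / INR (fact n))
    = exp (k * x0) * (k ^ n / INR (fact n)) * u ^ n).
  rewrite Rpow_mult_distr; unfold Rdiv; ring.
- exact (is_series_scal (exp (k * x0)) _ _ (is_series_exp (k * u))).
Qed.

(** Vanishing near the centre kills every coefficient, and the coefficients determine the sum on the
    whole interval. A single expansion therefore carries an identity from the centre to the edge,
    with no chain of discs. *)
Lemma has_power_series_identity (f : R -> R) (x0 r d : R) :
  0 < d -> has_power_series f x0 r ->
  (forall u, Rabs u < d -> f (x0 + u) = 0) ->
  forall u, Rabs u < r -> f (x0 + u) = 0.
Proof.
intros Hd [a Ha] H0 u Hu.
assert (Hr : 0 < r) by (pose proof (Rabs_pos u); lra).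
assert (Hrad : Rbar_lt 0 (CV_radius a)).
{ rewrite <- Rabs_R0; apply CV_radius_gt with r; [|rewrite Rabs_R0; exact Hr].
  intros v Hv; exists (f (x0 + v)); apply Ha, Hv. }
assert (Ha0 : forall n, a n = 0).
{ intros n; apply (PSeries_ext_recip a (fun _ => 0) n Hrad).
  - rewrite CV_radius_const_0; exact I.
  - exists (mkposreal (Rmin d r) (Rmin_pos _ _ Hd Hr)); intros v Hv.
    assert (Hv' : Rabs v < Rmin d r).
    { replace v with (v - 0) by ring; exact Hv. }
    rewrite PSeries_const_0.
    replace (PSeries a v) with (f (x0 + v)).
    + apply H0, (Rlt_le_trans _ _ _ Hv'), Rmin_l.
    + symmetry; apply is_pseries_unique, is_pseries_R, Ha.
      apply (Rlt_le_trans _ _ _ Hv'), Rmin_r. }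
rewrite <- (is_series_unique _ _ (Ha u Hu)).
apply is_series_unique.
apply is_series_ext with (fun _ => 0); [intros n; rewrite Ha0; symmetry; apply Rmult_0_l|].
apply (is_lim_seq_ext (fun _ => 0) _ (Finite 0)); [|apply is_lim_seq_const].
intros n; rewrite sum_n_const; symmetry; apply Rmult_0_r.
Qed.

Lemma sum_n_le_exp (z : R) (n : nat) : 0 <= z ->
  sum_n (fun n => z ^ n / INR (fact n)) n <= exp z.
Proof.
intros Hz.
apply (is_lim_seq_incr_compare _ (exp z) (is_series_exp z)).
intros k; rewrite sum_Sn; unfold plus; simpl.
assert (0 <= z ^ S k / INR (fact (S k))); [|simpl in *; lra].
apply Rdiv_le_0_compat; [apply pow_le, Hz | apply INR_fact_lt_0].
Qed.

Lemma pow_fact_le_exp (z : R) (n : nat) : 0 <= z -> z ^ n / INR (fact n) <= exp z.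
Proof.
intros Hz; apply Rle_trans with (2 := sum_n_le_exp z n Hz).
assert (Ht : forall k, 0 <= z ^ k / INR (fact k)).
{ intros k; apply Rdiv_le_0_compat; [apply pow_le, Hz | apply INR_fact_lt_0]. }
destruct n as [|n]; [rewrite sum_O; lra|].
rewrite sum_Sn.
assert (0 <= sum_n (fun n => z ^ n / INR (fact n)) n).
{ clear - Ht; induction n as [|n IH]; [rewrite sum_O; apply Ht|].
  rewrite sum_Sn; apply Rplus_le_le_0_compat; [exact IH | apply Ht]. }
unfold plus; simpl in *; lra.
Qed.

Lemma sum_n_diff_le (a b : nat -> R) (c : R) (N : nat) :
  (forall n, (N < n)%nat -> Rabs (a n) <= c * b n) ->
  forall k, Rabs (sum_n a (k + N) - sum_n a N) <= c * (sum_n b (k + N) - sum_n b N).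
Proof.
intros Hab k; induction k as [|k IH].
- rewrite plus_O_n, !Rminus_diag, Rabs_R0; lra.
- rewrite plus_Sn_m, !sum_Sn; specialize (Hab (S (k + N)) ltac:(lia)).
  change (Rabs (sum_n a (k + N) + a (S (k + N)) - sum_n a N) <=
    c * (sum_n b (k + N) + b (S (k + N)) - sum_n b N)).
  replace (sum_n a (k + N) + a (S (k + N)) - sum_n a N)
    with ((sum_n a (k + N) - sum_n a N) + a (S (k + N))) by ring.
  eapply Rle_trans; [apply Rabs_triang|]; lra.
Qed.

(* Unlike the Lagrange remainder, this bound loses only a factor p > 1 in the
   exponent, so that Laplace transforms expand in the full half-plane disc. *)
Lemma exp_remainder_le (p z : R) (N : nat) : 1 <= p ->
  Rabs (exp z - sum_n (fun n => z ^ n / INR (fact n)) N)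
    <= exp (p * Rabs z) / p ^ S N.
Proof.
intros Hp.
set (S1 := sum_n (fun n => z ^ n / INR (fact n))).
set (S2 := sum_n (fun n => (p * Rabs z) ^ n / INR (fact n))).
assert (HpN : 0 < p ^ S N) by (apply pow_lt; lra).
assert (Hpz : 0 <= p * Rabs z) by (apply Rmult_le_pos; [lra | apply Rabs_pos]).
assert (HK : forall k, Rabs (S1 (k + N)%nat - S1 N)
   <= / p ^ S N * (S2 (k + N)%nat - S2 N)).
(* For k > N one has p^k >= p^(N+1), so each term for [z] is at most p^(-N-1) times the term for
   p|z|. *)
{ apply sum_n_diff_le; intros k Hk.
  unfold Rdiv at 1; rewrite Rabs_mult, <- RPow_abs.
  rewrite (Rabs_right (/ _)) by (apply Rle_ge, Rlt_le, Rinv_0_lt_compat, INR_fact_lt_0).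
  rewrite Rpow_mult_distr.
  replace (p ^ k) with (p ^ (k - S N) * p ^ S N) by (rewrite <- pow_add; f_equal; lia).
  replace (/ p ^ S N * (p ^ (k - S N) * p ^ S N * Rabs z ^ k / INR (fact k)))
    with (p ^ (k - S N) * (Rabs z ^ k * / INR (fact k)))
    by (field; repeat split; try apply INR_fact_neq_0; try apply pow_nonzero; lra).
  assert (0 <= Rabs z ^ k * / INR (fact k)).
  { apply Rmult_le_pos; [apply pow_le, Rabs_pos|].
    apply Rlt_le, Rinv_0_lt_compat, INR_fact_lt_0. }
  pose proof (pow_R1_Rle p (k - S N) Hp); nra. }
apply (is_lim_seq_le (fun k => Rabs (S1 (k + N)%nat - S1 N))
   (fun _ => exp (p * Rabs z) / p ^ S N)
   (Finite (Rabs (exp z - S1 N))) (Finite (exp (p * Rabs z) / p ^ S N))).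
- intros k; apply Rle_trans with (1 := HK k).
  unfold Rdiv; rewrite Rmult_comm.
  apply Rmult_le_compat_r; [apply Rlt_le, Rinv_0_lt_compat, HpN|].
  assert (S2 (k + N)%nat <= exp (p * Rabs z)) by apply (sum_n_le_exp _ _ Hpz).
  assert (0 <= S2 N).
  { unfold S2; clear - Hpz; induction N as [|n IH].
    - rewrite sum_O; simpl; lra.
    - rewrite sum_Sn; apply Rplus_le_le_0_compat; [exact IH|].
      apply Rdiv_le_0_compat; [apply pow_le, Hpz | apply INR_fact_lt_0]. }
  lra.
- apply (is_lim_seq_abs _ (Finite (exp z - S1 N))).
  apply (is_lim_seq_minus' _ _ (exp z) (S1 N)); [|apply is_lim_seq_const].
  apply -> (is_lim_seq_incr_n S1 N); exact (is_series_exp z).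
- apply is_lim_seq_const.
Qed.

Lemma is_RInt_line_half_dom (f : R -> R) (M d : R) :
  0 < d -> 0 <= M -> (forall x y, ex_RInt f x y) ->
  (forall t, t < 0 -> f t = 0) ->
  (forall t, 0 <= t -> Rabs (f t) <= M * exp (- d * t)) ->
  exists I, is_RInt_line f I /\ Rabs I <= M * (1 + / d).
Proof.
intros Hd HM Hf H0 H1.
(* On the negative axis any rate would do; the choice 1 accounts for the summand 1 in the bound. *)
destruct (is_RInt_line_exp_dom f M M 1 d 0) as [I [HI HIb]]; try assumption; try lra.
- intros t [Ht | ->].
  + rewrite (H0 t Ht), Rabs_R0; apply Rmult_le_pos; [exact HM | apply Rlt_le, exp_pos].
  + replace (1 * 0) with (- d * 0) by ring; apply H1; lra.
- exists I; split; [exact HI|].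
  apply Rle_trans with (1 := HIb).
  rewrite !Rmult_0_r, exp_0; apply Req_le; field; lra.
Qed.

Lemma continuous_sum_n (f : nat -> R -> R) (n : nat) (x : R) :
  (forall k, continuous (f k) x) -> continuous (fun t => sum_n (fun k => f k t) n) x.
Proof.
intros Hf; induction n as [|n IH].
- apply continuous_ext with (f 0%nat); [intros t; now rewrite sum_O | apply Hf].
- apply continuous_ext with (fun t => plus (sum_n (fun k => f k t) n) (f (S n) t)).
  + intros t; now rewrite sum_Sn.
  + apply (continuous_plus (V := R_NormedModule)); [exact IH | apply Hf].
Qed.

(** Expansion of e^(-u t) under the integral. After the terms up to N the remainder is at most
    e^(p|u|t) / p^(N+1), still integrable against e^(-x0 t) [phi] as long as p|u| < x0 - c, and |u|
    < x0 - c leaves room for some p > 1. The error then decays like p^(-N-1), so the disc reaches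
    the abscissa [c] from an arbitrarily distant centre. *)
Lemma laplace_has_power_series (phi F : R -> R) (M c x0 : R) :
  c < x0 -> 0 <= M -> (forall x y, ex_RInt phi x y) ->
  (forall t, t < 0 -> phi t = 0) ->
  (forall t, 0 <= t -> Rabs (phi t) <= M * exp (c * t)) ->
  (forall s, c < s -> is_RInt_line (fun t => exp (- s * t) * phi t) (F s)) ->
  has_power_series F x0 (x0 - c).
Proof.
intros Hc HM Hphi Hphi0 Hphi1 HF.
assert (Hint := fun w => ex_RInt_mult_continuous_everywhere phi w Hphi).
set (term := fun n t => (- t) ^ n / INR (fact n) * exp (- x0 * t) * phi t).
set (a := fun n => RInt_gen (term n) (Rbar_locally m_infty) (Rbar_locally p_infty)).
assert (Ha : forall n, is_RInt_line (term n) (a n)).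
{ intros n.
  (* Half of the margin x0 - c absorbs the power of t, through (d t)^n / n! <= e^(d t); the other
     half remains as decay. *)
  set (d := (x0 - c) / 2).
  assert (Hd : 0 < d) by (unfold d; lra).
  assert (Hdn : 0 < d ^ n) by (apply pow_lt, Hd).
  destruct (is_RInt_line_half_dom (term n) (M / d ^ n) d) as [I [HI _]].
  - exact Hd.
  - apply Rdiv_le_0_compat; assumption.
  - apply (Hint (fun t => (- t) ^ n / INR (fact n) * exp (- x0 * t))).
    intros t; apply (ex_derive_continuous (V := R_NormedModule)); auto_derive; exact I.
  - intros t Ht; unfold term; rewrite Hphi0 by exact Ht; ring.
  - intros t Ht; unfold term; rewrite !Rabs_mult.
    rewrite (Rabs_right (exp _)) by (apply Rle_ge, Rlt_le, exp_pos).
    assert (H1 : Rabs ((- t) ^ n / INR (fact n)) <= exp (d * t) / d ^ n).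
    { unfold Rdiv; rewrite Rabs_mult, <- RPow_abs, Rabs_Ropp, (Rabs_right t) by lra.
      rewrite Rabs_right by (apply Rle_ge, Rlt_le, Rinv_0_lt_compat, INR_fact_lt_0).
      apply Rmult_le_reg_r with (d ^ n); [exact Hdn|].
      replace (exp (d * t) * / d ^ n * d ^ n) with (exp (d * t)) by (field; lra).
      apply Rle_trans with (2 := pow_fact_le_exp (d * t) n ltac:(nra)).
      rewrite Rpow_mult_distr; apply Req_le; field; apply INR_fact_neq_0. }
    replace (M / d ^ n * exp (- d * t))
      with (exp (d * t) / d ^ n * exp (- x0 * t) * (M * exp (c * t))).
    + apply Rmult_le_compat; [| apply Rabs_pos | | apply Hphi1, Ht].
      * apply Rmult_le_pos; [apply Rabs_pos | apply Rlt_le, exp_pos].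
      * apply Rmult_le_compat_r; [apply Rlt_le, exp_pos | exact H1].
    + transitivity (M / d ^ n * (exp (d * t) * exp (- x0 * t) * exp (c * t)));
        [field; lra|].
      rewrite <- !exp_plus; f_equal; f_equal; unfold d; field.
  - unfold a; rewrite (is_RInt_gen_unique _ _ HI); exact HI. }
exists a; intros u Hu.
(* The midpoint between 1 and the largest admissible factor (x0 - c) / |u|; the maximum with (x0 -
   c) / 2 keeps this factor finite for small [u]. *)
set (p := (1 + (x0 - c) / Rmax (Rabs u) ((x0 - c) / 2)) / 2).
assert (Hp : 1 < p /\ p * Rabs u < x0 - c).
{ set (m := Rmax (Rabs u) ((x0 - c) / 2)) in p.
  assert (Hm1 : Rabs u <= m) by apply Rmax_l.
  assert (Hm2 : (x0 - c) / 2 <= m) by apply Rmax_r.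
  assert (Hm3 : m < x0 - c) by (apply Rmax_lub_lt; lra).
  assert (Hq : (x0 - c) / m * m = x0 - c) by (field; lra).
  set (q := (x0 - c) / m) in *; pose proof (Rabs_pos u).
  assert (1 < q) by nra.
  unfold p; split; nra. }
destruct Hp as [Hp1 Hp2].
set (d := x0 - c - p * Rabs u) in *.
assert (Hd : 0 < d) by (unfold d; lra).
assert (Hb : forall N, Rabs (F (x0 + u) - sum_n (fun n => a n * u ^ n) N)
   <= M * (1 + / d) * (/ p) ^ S N).
{ intros N.
  assert (HpN : 0 < p ^ S N) by (apply pow_lt; lra).
  assert (Hpu : Rabs u <= p * Rabs u) by (pose proof (Rabs_pos u); nra).
  set (rem := fun t => (exp (- u * t) - sum_n (fun n => (- u * t) ^ n / INR (fact n)) N)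
      * exp (- x0 * t) * phi t).
  assert (Hrem : is_RInt_line rem (F (x0 + u) + (-1) * sum_n (fun n => a n * u ^ n) N)).
  { apply is_RInt_line_ext with (fun t => exp (- (x0 + u) * t) * phi t
       + (-1) * sum_n (fun n => u ^ n * term n t) N).
    - intros t; unfold rem, term.
      replace (sum_n (fun n => u ^ n * ((- t) ^ n / INR (fact n) * exp (- x0 * t) * phi t)) N)
        with (sum_n (fun n => (- u * t) ^ n / INR (fact n)) N * (exp (- x0 * t) * phi t)).
      + replace (- (x0 + u) * t) with (- u * t + - x0 * t) by ring.
        rewrite exp_plus; ring.
      + rewrite <- (sum_n_mult_r (K := R_Ring) (exp (- x0 * t) * phi t)).
        apply sum_n_ext; intros n.
        change ((- u * t) ^ n / INR (fact n) * (exp (- x0 * t) * phi t) =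
          u ^ n * ((- t) ^ n / INR (fact n) * exp (- x0 * t) * phi t)).
        replace (- u * t) with (u * - t) by ring; rewrite Rpow_mult_distr.
        unfold Rdiv; ring.
    - apply is_RInt_line_plus.
      + apply HF.
        destruct (Rabs_def2 _ _ Hu); lra.
      + apply is_RInt_line_scal, is_RInt_line_sum_n; intros n.
        rewrite Rmult_comm; apply is_RInt_line_scal, Ha. }
  replace (F (x0 + u) - sum_n (fun n => a n * u ^ n) N) with
    (F (x0 + u) + (-1) * sum_n (fun n => a n * u ^ n) N) by ring.
  destruct (is_RInt_line_half_dom rem (M / p ^ S N) d) as [I [HI HIb]].
  - exact Hd.
  - apply Rdiv_le_0_compat; assumption.
  - apply (Hint (fun t => (exp (- u * t) - sum_n (fun n => (- u * t) ^ n / INR (fact n)) N)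
      * exp (- x0 * t))).
    intros t; apply (continuous_mult (K := R_AbsRing)).
    + apply (continuous_minus (V := R_NormedModule)).
      * apply (ex_derive_continuous (V := R_NormedModule)); auto_derive; exact I.
      * apply continuous_sum_n; intros k.
        apply (ex_derive_continuous (V := R_NormedModule)); auto_derive; exact I.
    + apply (ex_derive_continuous (V := R_NormedModule)); auto_derive; exact I.
  - intros t Ht; unfold rem; rewrite Hphi0 by exact Ht; ring.
  - intros t Ht; unfold rem; rewrite !Rabs_mult.
    rewrite (Rabs_right (exp (- x0 * t))) by (apply Rle_ge, Rlt_le, exp_pos).
    replace (M / p ^ S N * exp (- d * t))
      with (exp (p * Rabs (- u * t)) / p ^ S N * exp (- x0 * t) * (M * exp (c * t))).
    + apply Rmult_le_compat; [| apply Rabs_pos | | apply Hphi1, Ht].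
      * apply Rmult_le_pos; [apply Rabs_pos | apply Rlt_le, exp_pos].
      * apply Rmult_le_compat_r; [apply Rlt_le, exp_pos|].
        apply exp_remainder_le; lra.
    + rewrite Rabs_mult, Rabs_Ropp, (Rabs_right t) by lra.
      transitivity (M / p ^ S N * (exp (p * (Rabs u * t)) * exp (- x0 * t) * exp (c * t)));
        [field; lra|].
      rewrite <- !exp_plus; f_equal; f_equal; unfold d; ring.
  - rewrite (is_RInt_line_unique _ _ _ Hrem HI).
    apply Rle_trans with (1 := HIb); apply Req_le.
    rewrite pow_inv; unfold Rdiv; ring. }
apply (is_lim_seq_spec _ (Finite (F (x0 + u)))); intros eps.
assert (Hlim : is_lim_seq (fun N => M * (1 + / d) * (/ p) ^ S N) 0).
{ replace (Finite 0) with (Rbar_mult (M * (1 + / d)) 0)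
    by (simpl; f_equal; ring).
  apply is_lim_seq_scal_l, (is_lim_seq_incr_1 (fun N => (/ p) ^ N)), is_lim_seq_geom.
  rewrite Rabs_right by (apply Rle_ge, Rlt_le, Rinv_0_lt_compat; lra).
  rewrite <- Rinv_1; apply Rinv_lt_contravar; lra. }
apply is_lim_seq_spec in Hlim; destruct (Hlim eps) as [N HN].
exists N; intros n Hn.
rewrite Rabs_minus_sym.
apply Rle_lt_trans with (1 := Hb n).
specialize (HN n Hn); rewrite Rminus_0_r in HN.
apply Rle_lt_trans with (2 := HN), Rle_abs.
Qed.

(** * Fourier series of the tent function *)

(** Domination by differences gives convergence together with an explicit error. It serves both the
    absolutely convergent series with weights 1/k^2 and the alternating eta series taken in
    pairs. *)
Lemma telescoping_series (a v : nat -> R) :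
  (forall n, Rabs (a n) <= v n - v (S n)) -> is_lim_seq v 0 ->
  exists l, is_series a l /\ forall N, Rabs (l - sum_n a N) <= v (S N).
Proof.
intros Hav Hv.
assert (Hdec : forall n, v (S n) <= v n).
{ intros n; pose proof (Hav n); pose proof (Rabs_pos (a n)); lra. }
assert (Hpos : forall n, 0 <= v n) by (intros n; exact (is_lim_seq_decr_compare v 0 Hv Hdec n)).
assert (Hb : forall N, sum_n (fun n => v n - v (S n)) N = v O - v (S N)).
{ induction N as [|N IH]; [now rewrite sum_O|].
  rewrite sum_Sn, IH; unfold plus; simpl; ring. }
assert (HK : forall k N, Rabs (sum_n a (k + N) - sum_n a N) <= v (S N)).
{ intros k N.
  pose proof (sum_n_diff_le a (fun n => v n - v (S n)) 1 N) as H.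
  eapply Rle_trans; [apply H|].
  - intros n _; rewrite Rmult_1_l; apply Hav.
  - rewrite !Hb; pose proof (Hpos (S (k + N))); lra. }
assert (Hcv : ex_finite_lim_seq (sum_n a)).
{ apply ex_lim_seq_cauchy_corr; intros eps.
  destruct (proj2 (is_lim_seq_spec v 0) Hv (pos_div_2 eps)) as [N HN].
  exists N; intros n m Hn Hm.
  assert (H : forall n, (N <= n)%nat -> Rabs (sum_n a n - sum_n a N) < eps / 2).
  { intros k Hk; replace k with ((k - N) + N)%nat by lia.
    apply Rle_lt_trans with (1 := HK (k - N)%nat N).
    specialize (HN (S N) ltac:(lia)); simpl in HN.
    rewrite Rminus_0_r, Rabs_right in HN by (apply Rle_ge, Hpos); exact HN. }
  pose proof (H n Hn); pose proof (H m Hm).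
  replace (sum_n a n - sum_n a m)
    with ((sum_n a n - sum_n a N) - (sum_n a m - sum_n a N)) by ring.
  eapply Rle_lt_trans; [apply Rabs_triang|]; rewrite Rabs_Ropp; lra. }
destruct Hcv as [l Hl]; exists l; split; [exact Hl|]; intros N.
apply (is_lim_seq_le (fun k => Rabs (sum_n a (k + N) - sum_n a N)) (fun _ => v (S N))
   (Finite (Rabs (l - sum_n a N))) (Finite (v (S N)))).
- intros k; apply HK.
- apply (is_lim_seq_abs _ (Finite (l - sum_n a N))).
  apply (is_lim_seq_minus' _ _ l (sum_n a N)); [|apply is_lim_seq_const].
  apply -> (is_lim_seq_incr_n (sum_n a) N); exact Hl.
- apply is_lim_seq_const.
Qed.

(** The versed sine 1 - cos, in place of cos, makes the series vanish at 0. Hence the value of zeta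
    at 2 never enters, and every dilate vanishes at the origin as well. *)
Definition verson_term (x : R) (k : nat) : R := (1 - cos (INR (S k) * x)) / INR (S k) ^ 2.

Definition verson_series (x : R) : R := Series (verson_term x).

Lemma is_lim_seq_div_S (c : R) : is_lim_seq (fun n => c / INR (S n)) 0.
Proof.
replace (Finite 0) with (Rbar_mult c (Rbar_inv p_infty)) by (simpl; f_equal; ring).
apply is_lim_seq_scal_l, is_lim_seq_inv; [|discriminate].
apply -> (is_lim_seq_incr_1 INR); exact is_lim_seq_INR.
Qed.

(** With m = k + 1 a term is at most 2/m^2 <= 4/(m (m + 1)) = 4/m - 4/(m + 1), which telescopes. *)
Lemma verson_series_spec (x : R) :
  is_series (verson_term x) (verson_series x) /\
  forall N, Rabs (verson_series x - sum_n (verson_term x) N) <= 4 / INR (S (S N)).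
Proof.
destruct (telescoping_series (verson_term x) (fun n => 4 / INR (S n))) as [l [Hl Hb]].
- intros n; unfold verson_term.
  rewrite (S_INR (S n)); set (m := INR (S n)).
  assert (Hm : 1 <= m) by (unfold m; rewrite S_INR; pose proof (pos_INR n); lra).
  pose proof (COS_bound (m * x)).
  rewrite Rabs_right.
  + apply Rle_trans with (2 / m ^ 2).
    * apply Rmult_le_compat_r; [apply Rlt_le, Rinv_0_lt_compat, pow_lt|]; lra.
    * apply Rminus_le.
      replace (2 / m ^ 2 - (4 / m - 4 / (m + 1))) with
        (- (2 * (m - 1) / (m ^ 2 * (m + 1)))) by (field; lra).
      assert (0 <= 2 * (m - 1) / (m ^ 2 * (m + 1))); [|lra].
      apply Rdiv_le_0_compat; [lra | apply Rmult_lt_0_compat; [apply pow_lt|]; lra].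
  + apply Rle_ge, Rdiv_le_0_compat; [lra | apply pow_lt; lra].
- apply is_lim_seq_div_S.
- unfold verson_series; rewrite (is_series_unique _ _ Hl); split; assumption.
Qed.

Lemma continuous_uniform_limit (f : R -> R) (x : R) :
  (forall eps, 0 < eps -> exists g, continuous g x /\ forall y, Rabs (f y - g y) <= eps) ->
  continuous f x.
Proof.
intros Hf; apply filterlim_locally; intros eps.
assert (He : 0 < eps / 4) by (pose proof (cond_pos eps); lra).
destruct (Hf _ He) as [g [Hg Hfg]].
apply filter_imp with (2 := proj1 (filterlim_locally g (g x)) Hg (mkposreal _ He)); intros y Hy.
change (Rabs (g y - g x) < eps / 4) in Hy; change (Rabs (f y - f x) < eps).
replace (f y - f x) with ((f y - g y) + (g y - g x) - (f x - g x)) by ring.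
pose proof (Hfg x); pose proof (Hfg y).
eapply Rle_lt_trans; [apply Rabs_triang|]; rewrite Rabs_Ropp.
pose proof (Rabs_triang (f y - g y) (g y - g x)); lra.
Qed.

Lemma div_INR_SS_lt (c eps : R) : 0 < eps -> exists N, forall n, (N <= n)%nat -> c / INR (S (S n)) < eps.
Proof.
intros He.
destruct (proj2 (is_lim_seq_spec _ 0) (is_lim_seq_div_S c) (mkposreal _ He)) as [N HN].
exists N; intros n Hn; specialize (HN (S n) ltac:(lia)); cbn [pos] in HN.
rewrite Rminus_0_r in HN; apply Rle_lt_trans with (2 := HN), Rle_abs.
Qed.

Lemma continuous_verson_series (x : R) : continuous verson_series x.
Proof.
apply continuous_uniform_limit; intros eps He.
destruct (div_INR_SS_lt 4 eps He) as [N HN].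
exists (fun y => sum_n (verson_term y) N); split.
- apply (continuous_sum_n (fun k y => verson_term y k)); intros k.
  apply (ex_derive_continuous (V := R_NormedModule)); unfold verson_term.
  auto_derive; exact I.
- intros y; apply Rle_trans with (1 := proj2 (verson_series_spec y) N).
  apply Rlt_le, HN, le_n.
Qed.

Lemma verson_series_period (x : R) (n : nat) :
  verson_series (2 * PI * INR n + x) = verson_series x.
Proof.
apply Series_ext; intros k; unfold verson_term; do 2 f_equal.
replace (INR (S k) * (2 * PI * INR n + x))
  with (INR (S k) * x + 2 * INR (S k * n) * PI) by (rewrite mult_INR; ring).
apply cos_period.
Qed.

Lemma verson_series_0 : verson_series 0 = 0.
Proof.
apply is_series_unique.
apply is_series_ext with (fun _ => 0).
- intros k; unfold verson_term; rewrite Rmult_0_r, cos_0.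
  change (0 = (1 - 1) / INR (S k) ^ 2); unfold Rdiv; ring.
- apply (is_lim_seq_ext (fun _ => 0) _ (Finite 0)); [|apply is_lim_seq_const].
  intros n; rewrite sum_n_const; symmetry; apply Rmult_0_r.
Qed.

(** The factor 2 sin (x/2) turns each cosine into a difference of sines. The sum has N + 1 cosines,
    so the last frequency is (N + 1) + 1/2. *)
Lemma dirichlet_kernel (x : R) (N : nat) :
  2 * sin (x / 2) * (sum_n (fun k => cos (INR (S k) * x)) N + / 2)
    = sin ((INR N + 3 / 2) * x).
Proof.
assert (Hs : forall y, 2 * sin (x / 2) * cos y = sin (y + x / 2) - sin (y - x / 2)).
{ intros y; rewrite sin_plus, sin_minus; ring. }
induction N as [|N IH].
- rewrite sum_O, Rmult_plus_distr_l, Hs; simpl.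
  replace (1 * x + x / 2) with ((0 + 3 / 2) * x) by field.
  replace (1 * x - x / 2) with (x / 2) by field; field.
- rewrite sum_Sn; unfold plus; simpl AbelianMonoid.plus.
  change (2 * sin (x / 2) * (sum_n (fun k => cos (INR (S k) * x)) N
     + cos (INR (S (S N)) * x) + / 2) = sin ((INR (S N) + 3 / 2) * x)).
  replace (2 * sin (x / 2) * (sum_n (fun k => cos (INR (S k) * x)) N
     + cos (INR (S (S N)) * x) + / 2))
    with (2 * sin (x / 2) * (sum_n (fun k => cos (INR (S k) * x)) N + / 2)
     + 2 * sin (x / 2) * cos (INR (S (S N)) * x)) by ring.
  rewrite IH, Hs, !S_INR.
  replace ((INR N + 1 + 1) * x + x / 2) with ((INR N + 1 + 3 / 2) * x) by field.
  replace ((INR N + 1 + 1) * x - x / 2) with ((INR N + 3 / 2) * x) by field; ring.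
Qed.

Lemma sin_half_ge (d x : R) : 0 < d <= PI -> Rabs (x - PI) <= PI - d ->
  sin (d / 2) <= sin (x / 2).
Proof.
intros Hd Hx; apply Rabs_le_between in Hx.
destruct (Rle_dec x PI).
- apply sin_incr_1; lra.
- replace (sin (x / 2)) with (sin (PI - x / 2)) by apply sin_PI_x.
  apply sin_incr_1; lra.
Qed.

(** One integration by parts of the Dirichlet kernel. With n = N + 3/2 the derivative of [rho] is
    sin (n y) / (2 sin (y/2)); subtracting [q], its primitive to leading order in 1/n, leaves a
    derivative [dr] of size 1/n, because sin (y/2) stays above sin (d/2) for all y no farther from
    pi than x. At pi every sine of the partial sum vanishes, so [rho PI] is 0. *)
Lemma sawtooth_partial_le (d x : R) (N : nat) :
  0 < d <= PI -> Rabs (x - PI) <= PI - d ->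
  Rabs (sum_n (fun k => sin (INR (S k) * x) / INR (S k)) N - (PI - x) / 2)
    <= (PI / sin (d / 2) ^ 2 + 2 / sin (d / 2)) / INR (S N).
Proof.
intros Hd Hx.
set (m := sin (d / 2)).
assert (Hm : 0 < m) by (apply sin_gt_0; lra).
set (n := INR N + 3 / 2).
assert (Hn : 1 <= INR (S N) <= n).
{ unfold n; rewrite S_INR; pose proof (pos_INR N); lra. }
set (rho := fun y => sum_n (fun k => sin (INR (S k) * y) / INR (S k)) N - (PI - y) / 2).
set (q := fun y => - cos (n * y) / (2 * n * sin (y / 2))).
set (dr := fun y => - (cos (n * y) * cos (y / 2)) / (4 * n * sin (y / 2) ^ 2)).
assert (Hder : forall y, Rabs (y - PI) <= Rabs (x - PI) ->
  is_derive (fun y => rho y - q y) y (dr y) /\ Rabs (dr y) <= / (4 * n * m ^ 2)).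
{ intros y Hy.
  assert (Hs : m <= sin (y / 2)) by (apply sin_half_ge; lra).
  assert (Hs2 : 0 < m ^ 2 <= sin (y / 2) ^ 2).
  { split; [apply pow_lt, Hm | apply pow_incr; lra]. }
  split.
  - replace (dr y) with ((sum_n (fun k => cos (INR (S k) * y)) N + / 2) -
      (sin (n * y) / (2 * sin (y / 2)) +
         (cos (n * y) * cos (y / 2)) / (4 * n * sin (y / 2) ^ 2))).
    + apply (is_derive_minus (V := R_NormedModule) rho q y).
      * apply (is_derive_ext
          (fun y => sum_n (fun k => sin (INR (S k) * y) / INR (S k)) N + (y - PI) / 2)).
        { intros t; unfold rho; eq_R; field. }
        apply (is_derive_plus (V := R_NormedModule)).
        { apply (is_derive_sum_n (K := R_AbsRing) (V := R_NormedModule)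
            (fun k y => sin (INR (S k) * y) / INR (S k))).
          intros k _; assert (Hk : 0 < INR (S k)) by apply lt_0_INR, Nat.lt_0_succ.
          revert Hk; generalize (INR (S k)); intros c Hk.
          auto_derive; [exact I | field; lra]. }
        auto_derive; [exact I | field].
      * unfold q; auto_derive; [apply Rmult_integral_contrapositive_currified; lra|].
        change (y * / 2) with (y / 2); field; split; lra.
    + rewrite <- (dirichlet_kernel y N : _ = sin (n * y)); unfold dr; field; split; lra.
  - unfold dr, Rdiv; rewrite Rabs_mult, Rabs_Ropp, Rabs_mult.
    rewrite (Rabs_right (/ _)).
    2:{ apply Rle_ge, Rlt_le, Rinv_0_lt_compat, Rmult_lt_0_compat; lra. }
    rewrite <- (Rmult_1_l (/ (4 * n * m ^ 2))).
    apply Rmult_le_compat.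
    + apply Rmult_le_pos; apply Rabs_pos.
    + apply Rlt_le, Rinv_0_lt_compat, Rmult_lt_0_compat; lra.
    + rewrite <- (Rmult_1_l 1); apply Rmult_le_compat; try apply Rabs_pos;
        apply Rabs_le, COS_bound.
    + apply Rinv_le_contravar; [apply Rmult_lt_0_compat; lra|].
      apply Rmult_le_compat_l; lra. }
assert (Hq : forall y, Rabs (y - PI) <= Rabs (x - PI) -> Rabs (q y) <= / (2 * n * m)).
{ intros y Hy.
  assert (Hs : m <= sin (y / 2)) by (apply sin_half_ge; lra).
  unfold q, Rdiv; rewrite Rabs_mult, Rabs_Ropp.
  rewrite <- (Rmult_1_l (/ (2 * n * m))).
  rewrite (Rabs_right (/ _)) by
    (apply Rle_ge, Rlt_le, Rinv_0_lt_compat, Rmult_lt_0_compat; lra).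
  apply Rmult_le_compat; [apply Rabs_pos | | apply Rabs_le, COS_bound |].
  - apply Rlt_le, Rinv_0_lt_compat, Rmult_lt_0_compat; lra.
  - apply Rinv_le_contravar; [apply Rmult_lt_0_compat; lra|].
    apply Rmult_le_compat_l; lra. }
pose proof (bounded_variation _ dr _ PI x Hder) as HV.
assert (Hrpi : rho PI = 0).
{ unfold rho; rewrite Rminus_diag.
  rewrite (sum_n_ext _ (fun _ => 0)).
  - rewrite sum_n_const; unfold Rdiv; ring.
  - intros k; replace (sin (INR (S k) * PI)) with 0; [eq_R; unfold Rdiv; ring|].
    symmetry; apply sin_eq_0_1; exists (Z.of_nat (S k)); now rewrite INR_IZR_INZ. }
pose proof (Hq x (Rle_refl _)) as Hq1.
pose proof (Hq PI ltac:(rewrite Rminus_diag, Rabs_R0; apply Rabs_pos)) as Hq2.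
change (Rabs (rho x) <= (PI / m ^ 2 + 2 / m) / INR (S N)).
replace (rho x) with ((rho x - q x - (rho PI - q PI)) + (q x - q PI)) by (rewrite Hrpi; ring).
apply Rle_trans with ((PI / m ^ 2 + 2 / m) / n).
- eapply Rle_trans; [apply Rabs_triang|].
  apply Rle_trans with (/ (4 * n * m ^ 2) * PI + (/ (2 * n * m) + / (2 * n * m))).
  + apply Rplus_le_compat.
    * apply Rle_trans with (1 := HV), Rmult_le_compat_l; [|lra].
      apply Rlt_le, Rinv_0_lt_compat, Rmult_lt_0_compat; [lra | apply pow_lt, Hm].
    * eapply Rle_trans; [apply Rabs_triang|]; rewrite Rabs_Ropp; lra.
  + apply Rminus_le.
    replace (/ (4 * n * m ^ 2) * PI + (/ (2 * n * m) + / (2 * n * m)) -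
       (PI / m ^ 2 + 2 / m) / n) with (- (3 / 4 * PI / (n * m ^ 2) + / (n * m)))
      by (field; lra).
    assert (0 < 3 / 4 * PI / (n * m ^ 2)).
    { apply Rdiv_lt_0_compat; [lra | apply Rmult_lt_0_compat; [lra | apply pow_lt, Hm]]. }
    assert (0 < / (n * m)) by (apply Rinv_0_lt_compat, Rmult_lt_0_compat; lra).
    lra.
- apply Rmult_le_compat_l; [|apply Rinv_le_contravar; lra].
  assert (0 < PI / m ^ 2) by (apply Rdiv_lt_0_compat; [lra | apply pow_lt, Hm]).
  assert (0 < 2 / m) by (apply Rdiv_lt_0_compat; lra).
  lra.
Qed.

(** By the sawtooth estimate the derivatives of the partial sums approach (pi - t)/2 uniformly away
    from 0 and 2 pi, so on the open interval the series differs from the quadratic [B] by a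
    constant. Continuity at 0, where both vanish, shows that the constant is 0. *)
Lemma verson_series_formula (x : R) : 0 <= x <= 2 * PI ->
  verson_series x = PI * x / 2 - x ^ 2 / 4.
Proof.
intros Hx.
pose proof PI_RGT_0 as Hpi.
set (B := fun y => PI * y / 2 - y ^ 2 / 4).
assert (Hcst : forall y, 0 < y < 2 * PI ->
  verson_series y - B y = verson_series PI - B PI).
{ intros y Hy.
  set (d := Rmin y (2 * PI - y)).
  assert (Hd : 0 < d <= PI).
  { unfold d, Rmin; destruct (Rle_dec y (2 * PI - y)); lra. }
  assert (Hyd : Rabs (y - PI) <= PI - d).
  { apply Rabs_le; unfold d, Rmin; destruct (Rle_dec y (2 * PI - y)); lra. }
  set (K := PI / sin (d / 2) ^ 2 + 2 / sin (d / 2)).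
  assert (HN : forall N, Rabs ((sum_n (verson_term y) N - B y)
     - (sum_n (verson_term PI) N - B PI)) <= K * PI / INR (S N)).
  { intros N.
    apply Rle_trans with (K / INR (S N) * Rabs (y - PI)).
    - apply (bounded_variation (fun t => sum_n (verson_term t) N - B t)
        (fun t => sum_n (fun k => sin (INR (S k) * t) / INR (S k)) N - (PI - t) / 2)).
      intros t Ht; split; [|apply sawtooth_partial_le; lra].
      apply (is_derive_minus (V := R_NormedModule)
        (fun t => sum_n (verson_term t) N) B t).
      + apply (is_derive_sum_n (K := R_AbsRing) (V := R_NormedModule)
            (fun k t => verson_term t k)).
        intros k _; assert (Hk : 0 < INR (S k)) by apply lt_0_INR, Nat.lt_0_succ.
        unfold verson_term; revert Hk; generalize (INR (S k)); intros c Hk.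
        auto_derive; [exact I | field; lra].
      + unfold B; auto_derive; [exact I | field].
    - replace (K * PI / INR (S N)) with (K / INR (S N) * PI) by
        (unfold Rdiv; ring).
      apply Rmult_le_compat_l; [|lra].
      assert (0 < sin (d / 2)) by (apply sin_gt_0; lra).
      apply Rdiv_le_0_compat; [|apply lt_0_INR, Nat.lt_0_succ].
      unfold K; apply Rplus_le_le_0_compat; apply Rdiv_le_0_compat; try lra.
      apply pow_lt; lra. }
  apply Rminus_diag_uniq, Rabs_eq_0, Rle_antisym; [|apply Rabs_pos].
  apply (is_lim_seq_le _ _ (Finite (Rabs (verson_series y - B y - (verson_series PI - B PI))))
     (Finite 0) HN); [|apply is_lim_seq_div_S].
  apply (is_lim_seq_abs _ (Finite (verson_series y - B y - (verson_series PI - B PI)))).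
  apply is_lim_seq_minus'; apply is_lim_seq_minus'; try apply is_lim_seq_const;
    apply verson_series_spec. }
assert (H0 : verson_series PI - B PI = 0).
{ apply Rabs_eq_0, Rle_antisym; [|apply Rabs_pos].
  apply le_epsilon; intros eps He; rewrite Rplus_0_l.
  assert (Hc : continuous (fun y => verson_series y - B y) 0).
  { apply (continuous_minus (V := R_NormedModule)); [apply continuous_verson_series|].
    apply (ex_derive_continuous (V := R_NormedModule)); unfold B; auto_derive; exact I. }
  destruct (proj1 (filterlim_locally _ _) Hc (mkposreal _ He)) as [d Hd].
  set (y := Rmin (d / 2) PI).
  assert (Hy : 0 < y <= PI /\ y < d).
  { pose proof (cond_pos d); unfold y, Rmin; destruct (Rle_dec (d / 2) PI); lra. }
  assert (Hy0 : ball 0 d y).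
  { change (Rabs (y - 0) < d); rewrite Rminus_0_r, Rabs_right; lra. }
  specialize (Hd y Hy0).
  change (Rabs ((verson_series y - B y) - (verson_series 0 - B 0)) < eps) in Hd.
  rewrite Hcst, verson_series_0 in Hd by lra.
  replace (verson_series PI - B PI - (0 - B 0)) with (verson_series PI - B PI) in Hd
    by (unfold B; field).
  lra. }
change (verson_series x = B x).
destruct (Req_dec x 0) as [-> |Hx0]; [rewrite verson_series_0; unfold B; field|].
destruct (Req_dec x (2 * PI)) as [-> |Hx1].
- replace (2 * PI) with (2 * PI * INR 1 + 0) at 1 by (simpl; ring).
  rewrite verson_series_period, verson_series_0; unfold B; field.
- pose proof (Hcst x ltac:(lra)); lra.
Qed.

Lemma verson_series_shift (n : nat) (x : R) : 0 <= x <= 2 * PI ->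
  verson_series (2 * PI * INR n + x) = PI * x / 2 - x ^ 2 / 4.
Proof. intros Hx; rewrite verson_series_period; apply verson_series_formula, Hx. Qed.

(* On [0, 4] this is the tent function of height 1 supported on [1, 3]. *)
Definition tent (x : R) : R :=
  4 / PI ^ 2 * (verson_series (PI * x / 2) - 3 / 4 * verson_series (PI * x)
     + / 8 * verson_series (2 * PI * x)).

(** On an interval between consecutive integers the three arguments, reduced modulo 2 pi, stay in
    [0, 2 pi]. The three quadratics then combine to a linear function: the coefficients of x^2 are
    proportional to 1/4 - 3/4 + 4/8 = 0. *)
Lemma tent_piece0 (j : nat) (x : R) :
  4 * INR j <= x <= 4 * INR j + 1 -> tent x = 0.
Proof.
intros Hx; pose proof PI_RGT_0; unfold tent.
set (y := x - 4 * INR j) in *; assert (Hy : 0 <= y <= 1) by (unfold y; lra).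
replace (PI * x / 2) with (2 * PI * INR j + PI * y / 2) by (unfold y; field).
replace (PI * x) with (2 * PI * INR (2 * j) + PI * y)
  by (rewrite mult_INR; unfold y; simpl; ring).
replace (2 * PI * x) with (2 * PI * INR (4 * j) + 2 * PI * y)
  by (rewrite mult_INR; unfold y; simpl; ring).
rewrite !verson_series_shift by nra; field; lra.
Qed.

Lemma tent_piece1 (j : nat) (x : R) :
  4 * INR j + 1 <= x <= 4 * INR j + 2 -> tent x = x - (4 * INR j + 1).
Proof.
intros Hx; pose proof PI_RGT_0; unfold tent.
set (y := x - (4 * INR j + 1)) in *; assert (Hy : 0 <= y <= 1) by (unfold y; lra).
replace (PI * x / 2) with (2 * PI * INR j + PI * (y + 1) / 2) by (unfold y; field).
replace (PI * x) with (2 * PI * INR (2 * j) + PI * (y + 1))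
  by (rewrite mult_INR; unfold y; simpl; ring).
replace (2 * PI * x) with (2 * PI * INR (4 * j + 1) + 2 * PI * y)
  by (rewrite plus_INR, mult_INR; unfold y; simpl; ring).
rewrite !verson_series_shift by nra; field; lra.
Qed.

Lemma tent_piece2 (j : nat) (x : R) :
  4 * INR j + 2 <= x <= 4 * INR j + 3 -> tent x = 4 * INR j + 3 - x.
Proof.
intros Hx; pose proof PI_RGT_0; unfold tent.
set (y := x - (4 * INR j + 2)) in *; assert (Hy : 0 <= y <= 1) by (unfold y; lra).
replace (4 * INR j + 3 - x) with (1 - y) by (unfold y; ring).
replace (PI * x / 2) with (2 * PI * INR j + PI * (y + 2) / 2) by (unfold y; field).
replace (PI * x) with (2 * PI * INR (2 * j + 1) + PI * y)
  by (rewrite plus_INR, mult_INR; unfold y; simpl; ring).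
replace (2 * PI * x) with (2 * PI * INR (4 * j + 2) + 2 * PI * y)
  by (rewrite plus_INR, mult_INR; unfold y; simpl; ring).
rewrite !verson_series_shift by nra; field; lra.
Qed.

Lemma tent_piece3 (j : nat) (x : R) :
  4 * INR j + 3 <= x <= 4 * INR j + 4 -> tent x = 0.
Proof.
intros Hx; pose proof PI_RGT_0; unfold tent.
set (y := x - (4 * INR j + 3)) in *; assert (Hy : 0 <= y <= 1) by (unfold y; lra).
replace (PI * x / 2) with (2 * PI * INR j + PI * (y + 3) / 2) by (unfold y; field).
replace (PI * x) with (2 * PI * INR (2 * j + 1) + PI * (y + 1))
  by (rewrite plus_INR, mult_INR; unfold y; simpl; ring).
replace (2 * PI * x) with (2 * PI * INR (4 * j + 3) + 2 * PI * y)
  by (rewrite plus_INR, mult_INR; unfold y; simpl; ring).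
rewrite !verson_series_shift by nra; field; lra.
Qed.

Lemma continuous_tent (x : R) : continuous tent x.
Proof.
unfold tent.
assert (H : forall c, continuous (fun x => verson_series (c * x)) x).
{ intros c; apply continuous_comp; [|apply continuous_verson_series].
  apply (ex_derive_continuous (V := R_NormedModule)); auto_derive; exact I. }
apply (continuous_scal_r (V := R_NormedModule)).
apply (continuous_plus (V := R_NormedModule)).
- apply (continuous_minus (V := R_NormedModule)).
  + apply continuous_ext with (fun x => verson_series (PI / 2 * x)); [|apply H].
    intros y; f_equal; field.
  + apply (continuous_scal_r (V := R_NormedModule)), H.
- apply (continuous_scal_r (V := R_NormedModule)), H.
Qed.

Lemma tent_bounded : exists K, 0 <= K /\ forall x, Rabs (tent x) <= K.
Proof.
assert (H : forall x, Rabs (verson_series x) <= 4).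
{ intros x; pose proof (proj2 (verson_series_spec x) O) as H.
  rewrite sum_O in H; unfold verson_term in H; simpl in H.
  pose proof (COS_bound (1 * x)).
  apply Rabs_le_between in H; apply Rabs_le.
  assert ((1 - cos (1 * x)) / (1 * (1 * 1)) = 1 - cos (1 * x)) by field.
  assert (4 / (1 + 1) = 2) by field.
  lra. }
exists (4 / PI ^ 2 * 8).
assert (Hp : 0 < 4 / PI ^ 2) by (apply Rdiv_lt_0_compat; [lra | apply pow_lt, PI_RGT_0]).
split; [lra|]; intros x; unfold tent.
rewrite Rabs_mult, (Rabs_right (4 / PI ^ 2)) by lra.
apply Rmult_le_compat_l; [lra|].
pose proof (H (PI * x / 2)) as H1; pose proof (H (PI * x)) as H2.
pose proof (H (2 * PI * x)) as H3.
apply Rabs_le_between in H1, H2, H3; apply Rabs_le; lra.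
Qed.

(** * The functional equation *)

(** One period of 1, -2, 1, 0. It is a second difference, which is why summing twice by parts leads
    to a compactly supported bump in each period. *)
Definition block (f : nat -> R) (j : nat) : R :=
  f (4 * j + 1)%nat - 2 * f (4 * j + 2)%nat + f (4 * j + 3)%nat.

Lemma sum_n_S (a : nat -> R) (n : nat) : sum_n a (S n) = sum_n a n + a (S n).
Proof. exact (sum_Sn (G := R_AbelianMonoid) a n). Qed.

(** The sequence is 1 - 3 [2 divides k] + 2 [4 divides k]. With weights 1/k^2 the dilations by 2 and
    4 bring factors 1/4 and 1/16, whence the coefficients -3/4 and 1/8 of [tent]. *)
Lemma sum_n_block_dilate (f : nat -> R) (M : nat) :
  sum_n (block f) M =
    sum_n (fun k => f (S k)) (4 * M + 3) - 3 * sum_n (fun k => f (2 * S k)%nat) (2 * M + 1)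
      + 2 * sum_n (fun k => f (4 * S k)%nat) M.
Proof.
induction M as [|M IH].
- simpl Nat.add; simpl Nat.mul; rewrite !sum_n_S, !sum_O; unfold block; simpl; eq_R; ring.
- rewrite (sum_n_S (block f)), (sum_n_S (fun k => f (4 * S k)%nat)), IH.
  replace (4 * S M + 3)%nat with (S (S (S (S (4 * M + 3))))) by lia.
  replace (2 * S M + 1)%nat with (S (S (2 * M + 1))) by lia.
  rewrite !sum_n_S; unfold block.
  replace (4 * S M + 1)%nat with (S (S (4 * M + 3))) by lia.
  replace (4 * S M + 2)%nat with (S (S (S (4 * M + 3)))) by lia.
  replace (4 * S M + 3)%nat with (S (S (S (S (4 * M + 3))))) by lia.
  replace (2 * S (S (2 * M + 1)))%nat with (S (S (S (4 * M + 3)))) by lia.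
  replace (2 * S (S (S (2 * M + 1))))%nat with (S (S (S (S (S (4 * M + 3)))))) by lia.
  replace (4 * S (S M))%nat with (S (S (S (S (S (4 * M + 3)))))) by lia.
  eq_R; ring.
Qed.

(** The sequence is also the alternating one minus its copy on the even integers; for f k = k^(-s)
    this is the factor 1 - 2^(-s) in front of eta. *)
Lemma sum_n_block_alternate (f : nat -> R) (M : nat) :
  sum_n (block f) M =
    sum_n (fun k => (-1) ^ k * f (S k)) (4 * M + 3)
      - sum_n (fun k => (-1) ^ k * f (2 * S k)%nat) (2 * M + 1).
Proof.
assert (He : forall n, (-1) ^ (2 * n) = 1) by apply pow_1_even.
induction M as [|M IH].
- simpl Nat.add; simpl Nat.mul; rewrite !sum_n_S, !sum_O; unfold block; simpl; eq_R; ring.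
- rewrite (sum_n_S (block f)), IH.
  replace (4 * S M + 3)%nat with (S (S (S (S (4 * M + 3))))) by lia.
  replace (2 * S M + 1)%nat with (S (S (2 * M + 1))) by lia.
  rewrite !sum_n_S; unfold block.
  replace (4 * S M + 1)%nat with (S (S (4 * M + 3))) by lia.
  replace (4 * S M + 2)%nat with (S (S (S (4 * M + 3)))) by lia.
  replace (4 * S M + 3)%nat with (S (S (S (S (4 * M + 3))))) by lia.
  replace (2 * S (S (2 * M + 1)))%nat with (S (S (S (4 * M + 3)))) by lia.
  replace (2 * S (S (S (2 * M + 1))))%nat with (S (S (S (S (S (4 * M + 3)))))) by lia.
  assert (H4 : (-1) ^ (4 * M + 3) = -1).
  { replace (4 * M + 3)%nat with (S (2 * (2 * M + 1))) by lia; rewrite <- tech_pow_Rmult, He; ring. }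
  assert (H2 : (-1) ^ (2 * M + 1) = -1).
  { replace (2 * M + 1)%nat with (S (2 * M)) by lia; rewrite <- tech_pow_Rmult, He; ring. }
  rewrite <- !tech_pow_Rmult, H4, H2; eq_R; ring.
Qed.

Definition tent_part (M : nat) (x : R) : R :=
  4 / PI ^ 2 * sum_n (block (fun k => (1 - cos (INR k * (PI * x / 2))) / INR k ^ 2)) M.

Lemma sum_n_scal (c : R) (a : nat -> R) (n : nat) :
  sum_n (fun k => c * a k) n = c * sum_n a n.
Proof. exact (sum_n_mult_l (K := R_Ring) c a n). Qed.

(** The three series are cut at different lengths, the shortest having index M, so each error is at
    most 4/(M + 2). The weights 1, 3/4, 1/8 add up to less than 2, and 4/pi^2 <= 1. *)
Lemma tent_part_close (M : nat) (x : R) :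
  Rabs (tent x - tent_part M x) <= 8 / INR (S (S M)).
Proof.
unfold tent, tent_part; rewrite sum_n_block_dilate.
set (th := PI * x / 2).
replace (PI * x) with (2 * th) by (unfold th; field).
replace (2 * PI * x) with (4 * th) by (unfold th; field).
assert (H2 : sum_n (fun k => (1 - cos (INR (2 * S k) * th)) / INR (2 * S k) ^ 2) (2 * M + 1)
   = / 4 * sum_n (verson_term (2 * th)) (2 * M + 1)).
{ rewrite <- sum_n_scal; apply sum_n_ext; intros k; eq_R; unfold verson_term.
  rewrite mult_INR; replace (INR 2) with 2 by reflexivity.
  replace (2 * INR (S k) * th) with (INR (S k) * (2 * th)) by ring.
  field; apply not_0_INR; lia. }
assert (H4 : sum_n (fun k => (1 - cos (INR (4 * S k) * th)) / INR (4 * S k) ^ 2) M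
   = / 16 * sum_n (verson_term (4 * th)) M).
{ rewrite <- sum_n_scal; apply sum_n_ext; intros k; eq_R; unfold verson_term.
  rewrite mult_INR; replace (INR 4) with 4 by (simpl; ring).
  replace (4 * INR (S k) * th) with (INR (S k) * (4 * th)) by ring.
  field; apply not_0_INR; lia. }
rewrite H2, H4; clear H2 H4.
change (fun k => (1 - cos (INR (S k) * th)) / INR (S k) ^ 2) with (verson_term th).
pose proof (proj2 (verson_series_spec th) (4 * M + 3)%nat) as A1.
pose proof (proj2 (verson_series_spec (2 * th)) (2 * M + 1)%nat) as A2.
pose proof (proj2 (verson_series_spec (4 * th)) M) as A3.
set (r := 4 / INR (S (S M))) in *.
assert (HM : 0 < INR (S (S M))) by (apply lt_0_INR; lia).
assert (Hr : 0 < r) by (apply Rdiv_lt_0_compat; lra).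
assert (A1' : 4 / INR (S (S (4 * M + 3))) <= r).
{ apply Rmult_le_compat_l; [lra|]; apply Rinv_le_contravar; [exact HM | apply le_INR; lia]. }
assert (A2' : 4 / INR (S (S (2 * M + 1))) <= r).
{ apply Rmult_le_compat_l; [lra|]; apply Rinv_le_contravar; [exact HM | apply le_INR; lia]. }
assert (Hp : 0 < 4 / PI ^ 2 <= 1).
{ pose proof PI2_1.
  assert (4 <= PI ^ 2) by nra.
  split; [apply Rdiv_lt_0_compat; lra|].
  apply Rmult_le_reg_r with (PI ^ 2); [lra|].
  replace (4 / PI ^ 2 * PI ^ 2) with 4 by (field; lra); lra. }
replace (8 / INR (S (S M))) with (1 * (2 * r)) by (unfold r; field; lra).
rewrite <- Rmult_minus_distr_l, Rabs_mult, (Rabs_right (4 / PI ^ 2)) by lra.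
apply Rmult_le_compat; try apply Rabs_pos; try lra.
apply Rabs_le_between in A1, A2, A3; apply Rabs_le; lra.
Qed.

(** A block centred at the angle c equals 2 (cos th - 1) cos c, and 2 sin (2 th) cos c is sin (c + 2
    th) - sin (c - 2 th). The centres are 4 th apart, so the sum telescopes. *)
Lemma sum_n_block_cos (th : R) (M : nat) :
  sin (2 * th) * sum_n (block (fun k => cos (INR k * th))) M
    = (cos th - 1) * sin (4 * INR (S M) * th).
Proof.
assert (Hb : forall j, sin (2 * th) * block (fun k => cos (INR k * th)) j
   = (cos th - 1) * (sin (4 * INR (S j) * th) - sin (4 * INR j * th))).
{ intros j; unfold block; rewrite S_INR, !plus_INR, mult_INR; simpl INR.
  replace ((1 + 1 + 1 + 1) * INR j) with (4 * INR j) by ring.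
  set (c := (4 * INR j + 2) * th).
  replace ((4 * INR j + 1) * th) with (c - th) by (unfold c; ring).
  replace ((4 * INR j + (1 + 1)) * th) with c by (unfold c; ring).
  replace ((4 * INR j + (1 + 1 + 1)) * th) with (c + th) by (unfold c; ring).
  replace (4 * (INR j + 1) * th) with (c + 2 * th) by (unfold c; ring).
  replace (4 * INR j * th) with (c - 2 * th) by (unfold c; ring).
  rewrite (cos_plus c th), (cos_minus c th), (sin_plus c (2 * th)), (sin_minus c (2 * th)); ring. }
induction M as [|M IH].
- rewrite sum_O, Hb; simpl INR; rewrite Rmult_0_r, Rmult_0_l, sin_0; ring.
- rewrite sum_n_S, Rmult_plus_distr_l, IH, Hb; ring.
Qed.

(** For 0 < th <= pi/3 the closed form bounds sin (2 th) times the sum by 1 - cos th <= sin th,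
    while sin (2 th) = 2 sin th cos th >= sin th. *)
Lemma sum_n_block_cos_le (th : R) (M : nat) : Rabs th <= PI / 3 ->
  Rabs (sum_n (block (fun k => cos (INR k * th))) M) <= 1.
Proof.
pose proof PI_RGT_0 as Hpi.
assert (Hpos : forall th, 0 < th <= PI / 3 ->
  Rabs (sum_n (block (fun k => cos (INR k * th))) M) <= 1).
{ clear th; intros th Hth.
  set (s := sum_n _ M).
  pose proof (sum_n_block_cos th M) as H; fold s in H.
  assert (Hs : 0 < sin th) by (apply sin_gt_0; lra).
  assert (Hc : / 2 <= cos th).
  { replace (/ 2) with (cos (PI / 3)) by (rewrite cos_PI3; field).
    apply cos_decr_1; lra. }
  assert (Hc1 : cos th <= 1) by apply COS_bound.
  assert (Hcs : 1 - cos th <= sin th).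
  { pose proof (sin2_cos2 th) as H2; unfold Rsqr in H2; nra. }
  rewrite sin_2a in H.
  assert (Hb : Rabs (2 * sin th * cos th * s) <= sin th).
  { rewrite H, Rabs_mult, (Rabs_left1 (cos th - 1)) by lra.
    apply Rle_trans with (- (cos th - 1) * 1); [|lra].
    apply Rmult_le_compat_l; [lra | apply Rabs_le, SIN_bound]. }
  rewrite !Rabs_mult, (Rabs_right 2), (Rabs_right (sin th)), (Rabs_right (cos th)) in Hb by lra.
  assert (0 <= sin th * (Rabs s * (2 * cos th - 1))).
  { apply Rmult_le_pos; [lra|]; apply Rmult_le_pos; [apply Rabs_pos | lra]. }
  apply Rmult_le_reg_l with (sin th); [exact Hs | lra]. }
intros Hth; destruct (Rtotal_order th 0) as [H|[-> |H]].
- rewrite (sum_n_ext _ (block (fun k => cos (INR k * - th)))).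
  + apply Hpos; rewrite Rabs_left in Hth by exact H; lra.
  + intros j; unfold block; rewrite <- !Ropp_mult_distr_r, !cos_neg; reflexivity.
- rewrite (sum_n_ext _ (fun _ => 0)).
  + rewrite sum_n_const, Rmult_0_r, Rabs_R0; lra.
  + intros j; unfold block; rewrite !Rmult_0_r, cos_0; eq_R; ring.
- apply Hpos; rewrite Rabs_right in Hth by lra; lra.
Qed.

Lemma is_derive_block (f df : nat -> R -> R) (j : nat) (x : R) :
  (forall k, (0 < k)%nat -> is_derive (f k) x (df k x)) ->
  is_derive (fun y => block (fun k => f k y) j) x (block (fun k => df k x) j).
Proof.
intros Hf; unfold block.
apply (is_derive_plus (V := R_NormedModule)); [|apply Hf; lia].
apply (is_derive_minus (V := R_NormedModule)); [apply Hf; lia|].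
apply (is_derive_scal (f (4 * j + 2)%nat)), Hf; lia.
Qed.

(** Near 0 [tent] vanishes but its partial Fourier sums do not, and the uniform error bound is
    worthless against x^(-s-2). A quadratic bound independent of M repairs this: the cosine sums are
    at most 1, so integrating twice from 0 gives the sine sums at most |th| and the versed sine sums
    at most th^2. For x <= 1/2 the angle pi x / 2 stays below pi/3. *)
Lemma tent_part_near_0 (M : nat) (x : R) : 0 <= x <= / 2 -> Rabs (tent_part M x) <= x ^ 2.
Proof.
intros Hx; pose proof PI_RGT_0 as Hpi.
set (g2 := fun th => sum_n (block (fun k => (1 - cos (INR k * th)) / INR k ^ 2)) M).
set (g1 := fun th => sum_n (block (fun k => sin (INR k * th) / INR k)) M).
assert (H1 : forall th, Rabs th <= PI / 3 -> Rabs (g1 th) <= Rabs th).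
{ intros th Hth.
  replace (g1 th) with (g1 th - g1 0).
  - replace th with (th - 0) at 2 by ring; rewrite <- (Rmult_1_l (Rabs (th - 0))).
    apply (bounded_variation g1 (fun t => sum_n (block (fun k => cos (INR k * t))) M)).
    intros t Ht; rewrite !Rminus_0_r in Ht.
    split; [|apply sum_n_block_cos_le; lra].
    apply (is_derive_sum_n (K := R_AbsRing) (V := R_NormedModule)
            (fun j t => block (fun k => sin (INR k * t) / INR k) j)).
    intros j _; apply (is_derive_block (fun k t => sin (INR k * t) / INR k)
       (fun k t => cos (INR k * t))).
    intros k Hk; apply lt_0_INR in Hk; revert Hk; generalize (INR k); intros c Hc.
    auto_derive; [exact I | field; lra].
  - unfold g1 at 2; rewrite (sum_n_ext _ (fun _ => 0)).
    + rewrite sum_n_const; ring.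
    + intros j; unfold block; rewrite !Rmult_0_r, sin_0; eq_R; unfold Rdiv; ring. }
assert (H2 : forall th, Rabs th <= PI / 3 -> Rabs (g2 th) <= th ^ 2).
{ intros th Hth.
  replace (g2 th) with (g2 th - g2 0).
  - replace (th ^ 2) with (Rabs th * Rabs (th - 0)).
    2:{ rewrite Rminus_0_r, <- Rabs_mult, Rabs_right by nra; ring. }
    apply (bounded_variation g2 g1).
    intros t Ht; rewrite !Rminus_0_r in Ht.
    split; [|apply Rle_trans with (2 := Ht), H1; lra].
    apply (is_derive_sum_n (K := R_AbsRing) (V := R_NormedModule)
            (fun j t => block (fun k => (1 - cos (INR k * t)) / INR k ^ 2) j)).
    intros j _; apply (is_derive_block (fun k t => (1 - cos (INR k * t)) / INR k ^ 2)
       (fun k t => sin (INR k * t) / INR k)).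
    intros k Hk; apply lt_0_INR in Hk; revert Hk; generalize (INR k); intros c Hc.
    auto_derive; [exact I | field; lra].
  - unfold g2 at 2; rewrite (sum_n_ext _ (fun _ => 0)).
    + rewrite sum_n_const; ring.
    + intros j; unfold block; rewrite !Rmult_0_r, cos_0; eq_R; unfold Rdiv; ring. }
unfold tent_part; fold (g2 (PI * x / 2)).
rewrite Rabs_mult, (Rabs_right (4 / PI ^ 2)).
2:{ apply Rle_ge, Rdiv_le_0_compat; [lra | apply pow_lt, Hpi]. }
replace (x ^ 2) with (4 / PI ^ 2 * (PI * x / 2) ^ 2) by (field; lra).
apply Rmult_le_compat_l; [apply Rdiv_le_0_compat; [lra | apply pow_lt, Hpi]|].
apply H2; rewrite Rabs_right; nra.
Qed.

(** * Mellin transforms of the tent function and of its partial Fourier sums *)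

(** At t = ln x this is the real part of e^(-i phi) x^(-b - i tau): the phases 0 and pi/2 give the
    real and imaginary parts of x^(-b - i tau). Multiplying by a complex number becomes mixing
    phases. *)
Definition wave (b tau phi t : R) : R := exp (- b * t) * cos (tau * t + phi).

Lemma Rabs_wave (b tau phi t : R) : Rabs (wave b tau phi t) <= exp (- b * t).
Proof.
unfold wave; rewrite Rabs_mult, (Rabs_right (exp _)) by (apply Rle_ge, Rlt_le, exp_pos).
rewrite <- (Rmult_1_r (exp (- b * t))) at 2.
apply Rmult_le_compat_l; [apply Rlt_le, exp_pos | apply Rabs_le, COS_bound].
Qed.

Lemma continuous_wave (b tau phi t : R) : continuous (wave b tau phi) t.
Proof.
apply (ex_derive_continuous (V := R_NormedModule)); unfold wave; auto_derive; exact I.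
Qed.

Lemma wave_shift (b tau phi u t : R) :
  wave b tau phi t = exp (b * u) * (cos (tau * u) * wave b tau phi (t + u)
     + sin (tau * u) * wave b tau (phi - PI / 2) (t + u)).
Proof.
unfold wave.
replace (exp (- b * t)) with (exp (b * u) * exp (- b * (t + u)))
  by (rewrite <- exp_plus; f_equal; ring).
replace (cos (tau * t + phi)) with (cos ((tau * (t + u) + phi) - tau * u)) by (f_equal; ring).
replace (cos (tau * (t + u) + (phi - PI / 2))) with (sin (tau * (t + u) + phi)).
- rewrite cos_minus; ring.
- rewrite <- cos_shift, <- cos_neg; f_equal; ring.
Qed.

Lemma continuous_tent_wave (b tau phi t : R) :
  continuous (fun t => tent (exp t) * wave b tau phi t) t.
Proof.
apply (continuous_mult (K := R_AbsRing)); [|apply continuous_wave].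
apply (continuous_comp exp tent); [|apply continuous_tent].
apply (ex_derive_continuous (V := R_NormedModule)); auto_derive; exact I.
Qed.

Lemma tent_exp_neg (t : R) : t <= 0 -> tent (exp t) = 0.
Proof.
intros Ht; apply (tent_piece0 0); simpl INR.
pose proof (exp_pos t); pose proof (exp_le_of_le t 0 Ht) as He; rewrite exp_0 in He; lra.
Qed.

Lemma one_minus_cos_le (y : R) : 0 <= y <= PI -> 1 - cos y <= y ^ 2 / 2.
Proof.
intros Hy; pose proof PI_RGT_0.
replace y with (2 * (y / 2)) at 1 by field; rewrite cos_2a_sin.
assert (0 <= sin (y / 2)) by (apply sin_ge_0; lra).
assert (sin (y / 2) <= y / 2).
{ destruct (proj1 Hy) as [Hy0|<-]; [apply Rlt_le, sin_lt_x; lra|].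
  unfold Rdiv; rewrite Rmult_0_l, sin_0; lra. }
nra.
Qed.

(** At 0 the factor 1 - cos = O(x^2) leaves x^(1-s), integrable against dx/x since s < 1; at
    infinity it is bounded and x^(-s-1) decays. *)
Lemma kernel_integral_exists (s tau phi : R) : 0 < s < 1 ->
  exists K, is_RInt_line (fun t => (1 - cos (PI / 2 * exp t)) * wave (s + 1) tau phi t) K.
Proof.
intros Hs; pose proof PI_RGT_0 as Hpi; pose proof PI_4 as Hpi4.
destruct (is_RInt_line_exp_dom
  (fun t => (1 - cos (PI / 2 * exp t)) * wave (s + 1) tau phi t) 2 2 (1 - s) (s + 1) 0)
  as [K [HK _]]; try lra.
- intros x y; apply (ex_RInt_continuous (V := R_CompleteNormedModule)); intros t _.
  apply (continuous_mult (K := R_AbsRing)); [|apply continuous_wave].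
  apply (ex_derive_continuous (V := R_NormedModule)); auto_derive; exact I.
- intros t Ht; rewrite Rabs_mult.
  assert (He : 0 < exp t <= 1).
  { split; [apply exp_pos|]; rewrite <- exp_0; apply exp_le_of_le, Ht. }
  apply Rle_trans with (2 * exp t ^ 2 * exp (- (s + 1) * t)).
  + apply Rmult_le_compat; try apply Rabs_pos; [|apply Rabs_wave].
    pose proof (COS_bound (PI / 2 * exp t)); rewrite Rabs_right by lra.
    eapply Rle_trans; [apply one_minus_cos_le; nra|].
    assert (PI * PI <= 16) by nra.
    replace ((PI / 2 * exp t) ^ 2 / 2) with (PI * PI / 8 * exp t ^ 2) by field.
    apply Rmult_le_compat_r; [apply pow2_ge_0 | lra].
  + apply Req_le; simpl; rewrite Rmult_1_r, Rmult_assoc, <- !exp_plus.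
    do 2 f_equal; ring.
- intros t Ht; rewrite Rabs_mult.
  apply Rmult_le_compat; try apply Rabs_pos; [|apply Rabs_wave].
  pose proof (COS_bound (PI / 2 * exp t)); rewrite Rabs_right; lra.
- exists K; exact HK.
Qed.

(** This is where the Gamma factor of the functional equation hides. Only its independence of k is
    ever used. *)
Definition kernel_integral (s tau phi : R) : R :=
  RInt_gen (fun t => (1 - cos (PI / 2 * exp t)) * wave (s + 1) tau phi t)
    (Rbar_locally m_infty) (Rbar_locally p_infty).

Lemma is_kernel_integral (s tau phi : R) : 0 < s < 1 ->
  is_RInt_line (fun t => (1 - cos (PI / 2 * exp t)) * wave (s + 1) tau phi t)
    (kernel_integral s tau phi).
Proof.
intros Hs; destruct (kernel_integral_exists s tau phi Hs) as [K HK].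
unfold kernel_integral; rewrite (is_RInt_gen_unique _ _ HK); exact HK.
Qed.

(** Translation by ln k, that is, the substitution of x/k for x, yields k^(s+1) / k^2 = k^(-(1-s)):
    the reflection of s to 1 - s takes place here. The rotation by tau ln k mixes the two phases. *)
Lemma kernel_integral_dilate (s tau phi : R) (k : nat) : 0 < s < 1 -> (0 < k)%nat ->
  is_RInt_line (fun t => (1 - cos (INR k * (PI * exp t / 2))) / INR k ^ 2
      * wave (s + 1) tau phi t)
    (kernel_integral s tau phi * wave (1 - s) tau 0 (ln (INR k))
     + kernel_integral s tau (phi - PI / 2) * wave (1 - s) tau (- (PI / 2)) (ln (INR k))).
Proof.
intros Hs Hk; apply lt_0_INR in Hk; set (c := INR k) in *.
assert (Hw : exp (- (1 - s) * ln c) = exp ((s + 1) * ln c) / c ^ 2).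
{ replace (- (1 - s) * ln c) with ((s + 1) * ln c + - ln c + - ln c) by ring.
  rewrite !exp_plus, exp_Ropp, (exp_ln c Hk); field; lra. }
unfold wave at 2 3; rewrite Hw, Rplus_0_r.
replace (cos (tau * ln c + - (PI / 2))) with (sin (tau * ln c))
  by (rewrite <- cos_shift, <- cos_neg; f_equal; ring).
apply is_RInt_line_ext with (fun t =>
   exp ((s + 1) * ln c) / c ^ 2 * cos (tau * ln c) *
     ((1 - cos (PI / 2 * exp (t + ln c))) * wave (s + 1) tau phi (t + ln c))
   + exp ((s + 1) * ln c) / c ^ 2 * sin (tau * ln c) *
     ((1 - cos (PI / 2 * exp (t + ln c))) * wave (s + 1) tau (phi - PI / 2) (t + ln c))).
- intros t; rewrite (wave_shift (s + 1) tau phi (ln c) t).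
  rewrite (exp_plus t), (exp_ln c Hk).
  replace (c * (PI * exp t / 2)) with (PI / 2 * (exp t * c)) by field.
  unfold Rdiv; ring.
- replace (kernel_integral s tau phi * (exp ((s + 1) * ln c) / c ^ 2 * cos (tau * ln c)) +
     kernel_integral s tau (phi - PI / 2) * (exp ((s + 1) * ln c) / c ^ 2 * sin (tau * ln c)))
   with (exp ((s + 1) * ln c) / c ^ 2 * cos (tau * ln c) * kernel_integral s tau phi +
     exp ((s + 1) * ln c) / c ^ 2 * sin (tau * ln c) * kernel_integral s tau (phi - PI / 2)) by ring.
  apply is_RInt_line_plus; apply is_RInt_line_scal;
    apply (is_RInt_line_shift (fun t => (1 - cos (PI / 2 * exp t)) * wave (s + 1) tau _ t));
    apply is_kernel_integral, Hs.
Qed.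

Lemma is_RInt_line_block (f : nat -> R -> R) (I : nat -> R) (j : nat) :
  (forall k, (0 < k)%nat -> is_RInt_line (f k) (I k)) ->
  is_RInt_line (fun t => block (fun k => f k t) j) (block I j).
Proof.
intros Hf; unfold block.
apply is_RInt_line_plus; [|apply Hf; lia].
apply (is_RInt_gen_minus (f (4 * j + 1)%nat) (fun t => 2 * f (4 * j + 2)%nat t));
  [|apply is_RInt_line_scal]; apply Hf; lia.
Qed.

Lemma tent_part_integral (s tau phi : R) (M : nat) : 0 < s < 1 ->
  is_RInt_line (fun t => tent_part M (exp t) * wave (s + 1) tau phi t)
    (4 / PI ^ 2 *
      (kernel_integral s tau phi * sum_n (block (fun k => wave (1 - s) tau 0 (ln (INR k)))) M
     + kernel_integral s tau (phi - PI / 2) *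
         sum_n (block (fun k => wave (1 - s) tau (- (PI / 2)) (ln (INR k)))) M)).
Proof.
intros Hs; apply is_RInt_line_ext with (fun t => 4 / PI ^ 2 * sum_n (fun j => block (fun k =>
   (1 - cos (INR k * (PI * exp t / 2))) / INR k ^ 2 * wave (s + 1) tau phi t) j) M).
- intros t; unfold tent_part; rewrite !Rmult_assoc; f_equal.
  rewrite <- (sum_n_mult_r (K := R_Ring)); apply sum_n_ext; intros j; eq_R.
  unfold block, mult; simpl; ring.
- apply is_RInt_line_scal; rewrite <- !sum_n_scal.
  rewrite <- (sum_n_plus (G := R_AbelianMonoid)).
  apply is_RInt_line_sum_n; intros j.
  set (K0 := kernel_integral s tau phi); set (K1 := kernel_integral s tau (phi - PI / 2)).
  match goal with |- is_RInt_gen _ _ _ ?v => replace (v : R) with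
    (block (fun k => K0 * wave (1 - s) tau 0 (ln (INR k))
       + K1 * wave (1 - s) tau (- (PI / 2)) (ln (INR k))) j : R)
    by (unfold block; eq_R; unfold plus; simpl; ring) end.
  apply is_RInt_line_block; intros k Hk; apply kernel_integral_dilate; assumption.
Qed.

(** The integrals [X M] of the partial sums tend to 0 by hypothesis. Their distance to the integral
    of [tent] is split at [t0]: on the right the uniform error applies, on the left [tent] is 0 and
    the bound x^2 leaves e^((1-s) t0) / (1 - s). The order of limits matters, since the right error
    carries the factor e^(-(s+1) t0): M goes to infinity for fixed [t0], and only afterwards [t0] to
    minus infinity. *)
Lemma tent_transform_zero (s tau phi : R) : 0 < s < 1 ->
  (forall psi, is_lim_seq (sum_n (block (fun k => wave (1 - s) tau psi (ln (INR k))))) 0) ->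
  is_RInt_line (fun t => tent (exp t) * wave (s + 1) tau phi t) 0.
Proof.
intros Hs H0.
destruct tent_bounded as [B [HB0 HB]].
destruct (is_RInt_line_exp_dom (fun t => tent (exp t) * wave (s + 1) tau phi t)
   0 B (1 - s) (s + 1) 0) as [J [HJ _]]; try lra.
{ intros x y; apply (ex_RInt_continuous (V := R_CompleteNormedModule)); intros t _; apply continuous_tent_wave. }
{ intros t Ht; rewrite (tent_exp_neg t Ht), Rmult_0_l, Rabs_R0; lra. }
{ intros t _; rewrite Rabs_mult; apply Rmult_le_compat; try apply Rabs_pos;
    [apply HB | apply Rabs_wave]. }
enough (HJ0 : J = 0) by (rewrite HJ0 in HJ; exact HJ).
set (X := fun M => 4 / PI ^ 2 *
      (kernel_integral s tau phi * sum_n (block (fun k => wave (1 - s) tau 0 (ln (INR k)))) M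
     + kernel_integral s tau (phi - PI / 2) *
         sum_n (block (fun k => wave (1 - s) tau (- (PI / 2)) (ln (INR k)))) M)).
assert (HX : is_lim_seq X 0).
{ replace (Finite 0) with (Rbar_mult (4 / PI ^ 2)
    (kernel_integral s tau phi * 0 + kernel_integral s tau (phi - PI / 2) * 0))
    by (simpl; f_equal; ring).
  apply is_lim_seq_scal_l, is_lim_seq_plus'; apply (is_lim_seq_scal_l _ _ (Finite 0)), H0. }
assert (Hle : forall t0, t0 <= ln (/ 2) -> Rabs J <= / (1 - s) * exp ((1 - s) * t0)).
{ intros t0 Ht0.
  assert (Hd : forall M, Rabs (J - X M) <= 1 / (1 - s) * exp ((1 - s) * t0)
     + 8 / INR (S (S M)) / (s + 1) * exp (- (s + 1) * t0)).
  { intros M.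
    assert (HD := is_RInt_gen_minus _ _ _ _ HJ (tent_part_integral s tau phi M Hs)).
    assert (HM : 0 < 8 / INR (S (S M))).
    { apply Rdiv_lt_0_compat; [lra | apply lt_0_INR; lia]. }
    destruct (is_RInt_line_exp_dom (fun t => (tent (exp t) - tent_part M (exp t))
       * wave (s + 1) tau phi t) 1 (8 / INR (S (S M))) (1 - s) (s + 1) t0)
      as [D [HD' HDb]]; try lra.
    - intros x y; apply (ex_RInt_continuous (V := R_CompleteNormedModule)); intros t _.
      apply (continuous_mult (K := R_AbsRing)); [|apply continuous_wave].
      apply (continuous_minus (V := R_NormedModule)).
      + apply (continuous_comp exp tent); [|apply continuous_tent].
        apply (ex_derive_continuous (V := R_NormedModule)); auto_derive; exact I.
      + unfold tent_part; apply (continuous_scal_r (V := R_NormedModule)).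
        apply (continuous_sum_n (fun j t => block (fun k =>
          (1 - cos (INR k * (PI * exp t / 2))) / INR k ^ 2) j)); intros j.
        apply (ex_derive_continuous (V := R_NormedModule)); unfold block.
        auto_derive; exact I.
    - intros t Ht.
      assert (He : 0 < exp t <= / 2).
      { split; [apply exp_pos|]; rewrite <- (exp_ln (/ 2)) by lra.
        apply exp_le_of_le; lra. }
      rewrite tent_exp_neg.
      2:{ apply Rlt_le, exp_lt_inv; rewrite exp_0; lra. }
      rewrite Rminus_0_l, Rabs_mult, Rabs_Ropp, Rmult_1_l.
      apply Rle_trans with (exp t ^ 2 * exp (- (s + 1) * t)).
      + apply Rmult_le_compat; try apply Rabs_pos; [|apply Rabs_wave].
        apply tent_part_near_0; lra.
      + apply Req_le; simpl; rewrite Rmult_1_r, <- !exp_plus; f_equal; ring.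
    - intros t _; rewrite Rabs_mult; apply Rmult_le_compat; try apply Rabs_pos;
        [apply tent_part_close | apply Rabs_wave].
    - replace (J - X M) with D; [exact HDb|].
      apply (is_RInt_line_unique _ _ _ HD').
      apply is_RInt_line_ext with (2 := HD); intros t; unfold X, minus, plus, opp; simpl; ring. }
  apply (is_lim_seq_le _ _ (Finite (Rabs J)) (Finite (/ (1 - s) * exp ((1 - s) * t0))) Hd).
  - replace (Finite (Rabs J)) with (Rbar_abs (Finite (J - 0)))
      by (simpl; now rewrite Rminus_0_r).
    apply is_lim_seq_abs, is_lim_seq_minus'; [apply is_lim_seq_const | exact HX].
  - replace (Finite (/ (1 - s) * exp ((1 - s) * t0))) with
      (Finite (1 / (1 - s) * exp ((1 - s) * t0) + 0 * (/ (s + 1) * exp (- (s + 1) * t0))))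
      by (f_equal; field; lra).
    apply is_lim_seq_plus'; [apply is_lim_seq_const|].
    apply is_lim_seq_ext with
      (fun M => 8 / INR (S (S M)) * (/ (s + 1) * exp (- (s + 1) * t0))).
    + intros M; unfold Rdiv; ring.
    + apply (is_lim_seq_scal_r _ _ (Finite 0)).
      apply -> (is_lim_seq_incr_1 (fun M => 8 / INR (S M))); apply is_lim_seq_div_S. }
apply Rabs_eq_0, Rle_antisym; [|apply Rabs_pos].
apply le_epsilon; intros eps He; rewrite Rplus_0_l.
destruct (exp_linear_lt (1 - s) (/ (1 - s)) eps) as [T [HT0 HT]]; [lra| |exact He|].
{ apply Rlt_le, Rinv_0_lt_compat; lra. }
apply Rle_trans with (1 := Hle (Rmin (ln (/ 2)) (- T)) (Rmin_l _ _)).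
apply Rlt_le, HT, Rmin_r.
Qed.

(** * The eta function as a transform of the tent function *)

(* The real part of e^{-i phi} s (s + 1) (e^t - a) e^{-(s + 1) t}, s = sg + i tau. *)
Definition linear_wave (sg tau phi a t : R) : R :=
  (exp t - a) * ((sg ^ 2 + sg - tau ^ 2) * wave (sg + 1) tau phi t
     + (2 * sg + 1) * tau * wave (sg + 1) tau (phi - PI / 2) t).

(** Real part of e^(-i phi) (- (s + 1) e^(-s t) + a s e^(-(s+1) t)), with s = sg + i tau. *)
Definition linear_wave_primitive (sg tau phi a t : R) : R :=
  exp (- sg * t) * (- (sg + 1) * cos (tau * t + phi) - tau * sin (tau * t + phi))
  + a * exp (- (sg + 1) * t) * (sg * cos (tau * t + phi) + tau * sin (tau * t + phi)).

Lemma cos_sub_PI2 (x : R) : cos (x - PI / 2) = sin x.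
Proof. rewrite <- cos_shift, <- cos_neg; f_equal; ring. Qed.

Lemma is_RInt_linear_wave (sg tau phi a x y : R) :
  is_RInt (linear_wave sg tau phi a) x y
    (linear_wave_primitive sg tau phi a y - linear_wave_primitive sg tau phi a x).
Proof.
apply (is_RInt_derive (linear_wave_primitive sg tau phi a)).
- intros t _; unfold linear_wave_primitive, linear_wave, wave.
  replace (tau * t + (phi - PI / 2)) with (tau * t + phi - PI / 2) by ring.
  rewrite cos_sub_PI2.
  auto_derive; [exact I|].
  replace (- sg * t) with (t + - (sg + 1) * t) by ring.
  rewrite exp_plus; ring.
- intros t _; apply (ex_derive_continuous (V := R_NormedModule)).
  unfold linear_wave, wave; auto_derive; exact I.
Qed.

Lemma linear_wave_primitive_ln (sg tau phi a x : R) : 0 < x ->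
  linear_wave_primitive sg tau phi a (ln x) =
    exp (- sg * ln x) * ((- (sg + 1) + a / x * sg) * cos (tau * ln x + phi)
       + (a / x - 1) * tau * sin (tau * ln x + phi)).
Proof.
intros Hx; unfold linear_wave_primitive.
replace (- (sg + 1) * ln x) with (- sg * ln x + - ln x) by ring.
rewrite exp_plus, exp_Ropp, (exp_ln x Hx); field; lra.
Qed.

Lemma is_RInt_tent_piece (sg tau phi c d a u v : R) :
  0 < u <= v -> (forall x, u <= x <= v -> tent x = c * (x - a)) ->
  c * (linear_wave_primitive sg tau phi a (ln v)
      - linear_wave_primitive sg tau phi a (ln u)) = d ->
  is_RInt (fun t => tent (exp t) * ((sg ^ 2 + sg - tau ^ 2) * wave (sg + 1) tau phi t
     + (2 * sg + 1) * tau * wave (sg + 1) tau (phi - PI / 2) t)) (ln u) (ln v) d.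
Proof.
intros Huv Ht <-.
assert (Hl : ln u <= ln v).
{ destruct (proj2 Huv) as [H| ->]; [apply Rlt_le, ln_increasing; lra | lra]. }
apply is_RInt_ext with (fun t => scal c (linear_wave sg tau phi a t)).
- rewrite Rmin_left, Rmax_right by exact Hl; intros t Htt; rewrite Ht.
  + unfold linear_wave, scal; simpl; unfold mult; simpl; ring.
  + rewrite <- (exp_ln u), <- (exp_ln v) by lra.
    split; apply exp_le_of_le; lra.
- apply (is_RInt_scal (linear_wave sg tau phi a)), is_RInt_linear_wave.
Qed.

(** Only the corners contribute. The primitive of a piece vanishing at [a] equals -a^(-s) at its
    zero, so the corners at 4j + 1 and 4j + 3 give coefficient 1, and the two pieces meeting at 4j +
    2 give -2: these are the jumps of the slope. *)
Lemma is_RInt_tent_block (sg tau phi : R) (j : nat) :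
  is_RInt (fun t => tent (exp t) * ((sg ^ 2 + sg - tau ^ 2) * wave (sg + 1) tau phi t
     + (2 * sg + 1) * tau * wave (sg + 1) tau (phi - PI / 2) t))
    (ln (4 * INR j + 1)) (ln (4 * INR j + 4))
    (block (fun k => wave sg tau phi (ln (INR k))) j).
Proof.
pose proof (pos_INR j) as Hj.
set (x := 4 * INR j + 2).
set (a := 4 * INR j + 1); set (b := 4 * INR j + 3).
assert (Hx : 0 < x) by (unfold x; lra).
assert (Ha : 0 < a) by (unfold a; lra).
assert (Hb : 0 < b) by (unfold b; lra).
set (W := wave sg tau phi).
replace (block (fun k => W (ln (INR k))) j) with
  (plus (1 * (linear_wave_primitive sg tau phi a (ln x) - linear_wave_primitive sg tau phi a (ln a)))
  (plus ((-1) * (linear_wave_primitive sg tau phi b (ln b) - linear_wave_primitive sg tau phi b (ln x)))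
    (0 * (linear_wave_primitive sg tau phi 0 (ln (4 * INR j + 4))
        - linear_wave_primitive sg tau phi 0 (ln b))))).
- apply (is_RInt_Chasles (V := R_NormedModule)) with (ln x); [|apply (is_RInt_Chasles (V := R_NormedModule)) with (ln b)].
  + eapply is_RInt_tent_piece; [| |reflexivity]; [unfold a, x; lra|].
    intros y Hy; rewrite (tent_piece1 j y) by (unfold a, x in Hy; lra); unfold a; ring.
  + eapply is_RInt_tent_piece; [| |reflexivity]; [unfold b, x; lra|].
    intros y Hy; rewrite (tent_piece2 j y) by (unfold b, x in Hy; lra); unfold b; ring.
  + eapply is_RInt_tent_piece; [| |reflexivity]; [unfold b; lra|].
    intros y Hy; rewrite (tent_piece3 j y) by (unfold b in Hy; lra); ring.
- unfold block; rewrite !plus_INR, mult_INR; simpl INR.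
  replace ((1 + 1 + 1 + 1) * INR j + 1) with a by (unfold a; ring).
  replace ((1 + 1 + 1 + 1) * INR j + (1 + 1)) with x by (unfold x; ring).
  replace ((1 + 1 + 1 + 1) * INR j + (1 + 1 + 1)) with b by (unfold b; ring).
  rewrite !linear_wave_primitive_ln by lra; unfold W, wave.
  change plus with Rplus.
  (* The peak is the midpoint of [a] and [b], so the contributions proportional to s cancel there up
     to the coefficient -2. *)
  replace (b / x) with (2 - a / x) by (unfold a, b, x; field; lra).
  replace (a / a) with 1 by (field; lra); replace (b / b) with 1 by (field; lra); eq_R; ring.
Qed.

Lemma is_RInt_tent_blocks (sg tau phi x : R) (M : nat) : x < 0 ->
  is_RInt (fun t => tent (exp t) * ((sg ^ 2 + sg - tau ^ 2) * wave (sg + 1) tau phi t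
     + (2 * sg + 1) * tau * wave (sg + 1) tau (phi - PI / 2) t))
    x (ln (4 * INR M + 4))
    (sum_n (block (fun k => wave sg tau phi (ln (INR k)))) M).
Proof.
intros Hx; induction M as [|M IH].
- rewrite sum_O, <- (Rplus_0_l (block _ 0)).
  apply (is_RInt_Chasles (V := R_NormedModule)) with 0.
  + apply is_RInt_ext with (fun _ => 0); [|apply is_RInt_zero].
    rewrite Rmin_left, Rmax_right by lra; intros t Ht.
    rewrite tent_exp_neg by lra; eq_R; ring.
  + pose proof (is_RInt_tent_block sg tau phi 0) as H.
    replace (ln (4 * INR 0 + 1)) with 0 in H
      by (simpl INR; rewrite Rmult_0_r, Rplus_0_l; symmetry; apply ln_1).
    exact H.
- rewrite sum_Sn; apply (is_RInt_Chasles (V := R_NormedModule)) with (1 := IH).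
  assert (Hz : is_RInt (fun t => tent (exp t) * ((sg ^ 2 + sg - tau ^ 2) * wave (sg + 1) tau phi t
     + (2 * sg + 1) * tau * wave (sg + 1) tau (phi - PI / 2) t))
     (ln (4 * INR M + 4)) (ln (4 * INR (S M) + 1))
     (0 * (linear_wave_primitive sg tau phi 0 (ln (4 * INR (S M) + 1))
        - linear_wave_primitive sg tau phi 0 (ln (4 * INR M + 4))))).
  { pose proof (pos_INR M).
    eapply is_RInt_tent_piece; [| |reflexivity]; rewrite S_INR; [lra|].
    intros y Hy; rewrite (tent_piece0 (S M) y) by (rewrite S_INR; lra); ring. }
  rewrite Rmult_0_l in Hz.
  rewrite <- (Rplus_0_l (block _ (S M))).
  exact (is_RInt_Chasles (V := R_NormedModule) _ _ _ _ _ _ Hz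
    (is_RInt_tent_block sg tau phi (S M))).
Qed.

(** The block sums are exactly the integral truncated at x = 4M + 4, so they inherit its limit. The
    coefficients are the real and imaginary parts of s (s + 1); the factor i turns phase [phi] into
    [phi - PI / 2]. *)
Lemma is_lim_seq_tent_blocks (sg tau phi I0 I1 : R) :
  is_RInt_line (fun t => tent (exp t) * wave (sg + 1) tau phi t) I0 ->
  is_RInt_line (fun t => tent (exp t) * wave (sg + 1) tau (phi - PI / 2) t) I1 ->
  is_lim_seq (sum_n (block (fun k => wave sg tau phi (ln (INR k)))))
    ((sg ^ 2 + sg - tau ^ 2) * I0 + (2 * sg + 1) * tau * I1).
Proof.
intros H0 H1.
assert (H : is_RInt_line (fun t => tent (exp t) *
     ((sg ^ 2 + sg - tau ^ 2) * wave (sg + 1) tau phi t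
     + (2 * sg + 1) * tau * wave (sg + 1) tau (phi - PI / 2) t))
    ((sg ^ 2 + sg - tau ^ 2) * I0 + (2 * sg + 1) * tau * I1)).
{ apply is_RInt_line_ext with (2 := is_RInt_line_plus _ _ _ _
    (is_RInt_line_scal _ (sg ^ 2 + sg - tau ^ 2) _ H0)
    (is_RInt_line_scal _ ((2 * sg + 1) * tau) _ H1)).
  intros t; ring. }
intros P HP; destruct (H P HP) as [Q1 Q2 [B1 HB1] [B2 HB2] HQ].
destruct (INR_unbounded (exp B2)) as [N HN].
exists N; intros M HM.
assert (HM' : B2 < ln (4 * INR M + 4)).
{ apply le_INR in HM; pose proof (pos_INR M).
  rewrite <- (ln_exp B2); apply ln_increasing; [apply exp_pos | lra]. }
set (x := Rmin B1 0 - 1).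
assert (Hx : x < B1 /\ x < 0).
{ pose proof (Rmin_l B1 0); pose proof (Rmin_r B1 0); unfold x; lra. }
destruct (HQ x (ln (4 * INR M + 4)) (HB1 _ (proj1 Hx)) (HB2 _ HM')) as [z [Hz HPz]].
replace (sum_n _ M) with z; [exact HPz|].
rewrite <- (is_RInt_unique (V := R_CompleteNormedModule) _ _ _ _ Hz).
apply (is_RInt_unique (V := R_CompleteNormedModule)), is_RInt_tent_blocks, Hx.
Qed.

(** * Convergence, phases and positivity of the eta series *)

Lemma is_lim_seq_exp_ln (s : R) : 0 < s -> is_lim_seq (fun n => exp (- s * ln (INR (S n)))) 0.
Proof.
intros Hs; apply is_lim_seq_spec; intros eps.
destruct (exp_linear_lt s 1 eps Hs ltac:(lra) (cond_pos eps)) as [B [HB0 HB]].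
destruct (INR_unbounded (exp B)) as [N HN].
exists N; intros n Hn.
rewrite Rminus_0_r, Rabs_right by (apply Rle_ge, Rlt_le, exp_pos).
replace (- s * ln (INR (S n))) with (s * (- ln (INR (S n)))) by ring.
rewrite <- (Rmult_1_l (exp _)); apply HB, Ropp_le_contravar.
rewrite <- (ln_exp B); apply Rlt_le, ln_increasing; [apply exp_pos|].
apply le_INR in Hn; rewrite S_INR; lra.
Qed.

(** The derivative of [wave] is at most (s + |tau|) e^(-s t), which is 1 + |tau|/s times the speed
    of decrease of e^(-s t). Adding that multiple of e^(-s t) to either sign of [wave] gives a
    decreasing function. *)
Lemma wave_variation_le (s tau phi x y : R) : 0 < s -> x <= y ->
  Rabs (wave s tau phi x - wave s tau phi y)
    <= (1 + Rabs tau / s) * (exp (- s * x) - exp (- s * y)).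
Proof.
intros Hs Hxy; set (C := 1 + Rabs tau / s).
assert (HC : forall e, Rabs e = 1 -> 0 <= e * (wave s tau phi x - wave s tau phi y)
    + C * (exp (- s * x) - exp (- s * y))).
{ intros e He.
  destruct (MVT_gen (fun t => e * wave s tau phi t + C * exp (- s * t)) x y
    (fun t => exp (- s * t) * (- (e * (s * cos (tau * t + phi) + tau * sin (tau * t + phi)))
        - C * s))) as [c [Hc Hm]].
  - intros t _; unfold wave; auto_derive; [exact I | ring].
  - intros t _; apply continuity_pt_filterlim.
    apply (ex_derive_continuous (V := R_NormedModule)
      (fun t => e * wave s tau phi t + C * exp (- s * t))).
    unfold wave; auto_derive; exact I.
  - assert (Hle : exp (- s * c) * (- (e * (s * cos (tau * c + phi) + tau * sin (tau * c + phi)))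
        - C * s) <= 0).
    { assert (- (e * (s * cos (tau * c + phi) + tau * sin (tau * c + phi))) <= C * s).
      { apply Rle_trans with (1 := Rle_abs _).
        rewrite Rabs_Ropp, Rabs_mult, He, Rmult_1_l.
        eapply Rle_trans; [apply Rabs_triang|]; rewrite !Rabs_mult, (Rabs_right s) by lra.
        replace (C * s) with (s * 1 + Rabs tau * 1) by (unfold C; field; lra).
        apply Rplus_le_compat; apply Rmult_le_compat_l; try lra; try apply Rabs_pos;
          apply Rabs_le; [apply COS_bound | apply SIN_bound]. }
      pose proof (exp_pos (- s * c)); nra. }
    assert (0 <= y - x) by lra.
    set (q := exp (- s * c) * _) in *.
    assert (q * (y - x) <= 0) by nra; lra. }
pose proof (HC 1 Rabs_R1) as H1.
pose proof (HC (-1) ltac:(rewrite Rabs_left; lra)) as H2.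
apply Rabs_le; lra.
Qed.

(** No absolute convergence is available for s <= 1, so consecutive terms are paired: a pair is
    bounded by a multiple of a difference of values of (k + 1)^(-s), and these telescope. *)
Lemma eta_real_converges (s tau phi : R) : 0 < s -> exists E : R,
  is_lim_seq (sum_n (fun k => (-1) ^ k * wave s tau phi (ln (INR (S k))))) E.
Proof.
intros Hs.
set (w := fun k => wave s tau phi (ln (INR (S k)))).
set (v := fun k => exp (- s * ln (INR (S k)))).
set (C := 1 + Rabs tau / s).
assert (HC : 1 <= C).
{ assert (0 <= Rabs tau / s) by (apply Rdiv_le_0_compat; [apply Rabs_pos | exact Hs]).
  unfold C; lra. }
assert (Hln : forall m n, (m <= n)%nat -> ln (INR (S m)) <= ln (INR (S n))).
{ intros m n Hmn; assert (0 < INR (S m)) by (apply lt_0_INR; lia).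
  destruct (le_INR (S m) (S n) ltac:(lia)) as [H0 | ->]; [apply Rlt_le, ln_increasing; lra | lra]. }
assert (Hvdec : forall m n, (m <= n)%nat -> v n <= v m).
{ intros m n Hmn; apply exp_le_of_le; specialize (Hln m n Hmn); nra. }
destruct (telescoping_series (fun j => w (2 * j)%nat - w (2 * j + 1)%nat)
   (fun j => C * v (2 * j)%nat)) as [E [_ HE]].
{ intros j; eapply Rle_trans.
  - apply wave_variation_le; [exact Hs | apply Hln; lia].
  - change (C * (v (2 * j)%nat - v (2 * j + 1)%nat) <= C * v (2 * j)%nat - C * v (2 * S j)%nat).
    rewrite <- Rmult_minus_distr_l; apply Rmult_le_compat_l; [lra|].
    pose proof (Hvdec (2 * j + 1)%nat (2 * S j)%nat ltac:(lia)); lra. }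
{ replace (Finite 0) with (Rbar_mult C 0) by (simpl; f_equal; ring).
  apply is_lim_seq_scal_l.
  apply (is_lim_seq_subseq v 0 (fun j => (2 * j)%nat)); [|apply is_lim_seq_exp_ln, Hs].
  apply eventually_subseq; intros n; lia. }
assert (Hodd : forall j, sum_n (fun k => (-1) ^ k * w k) (2 * j + 1) =
   sum_n (fun j => w (2 * j)%nat - w (2 * j + 1)%nat) j).
{ induction j as [|j IH].
  - simpl Nat.add; rewrite sum_n_S, !sum_O; simpl; eq_R; ring.
  - replace (2 * S j + 1)%nat with (S (S (2 * j + 1))) by lia.
    rewrite !sum_n_S, IH; replace (S (2 * j + 1)) with (2 * S j)%nat by lia.
    replace (S (2 * S j)) with (2 * S j + 1)%nat by lia.
    rewrite pow_add, pow_1_even; simpl pow; eq_R; ring. }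
(* For even [n] the sum stops inside a pair; the missing term accounts for the extra 1 in
   [C + 1]. *)
assert (Hall : forall n, Rabs (E - sum_n (fun k => (-1) ^ k * w k) n) <= (C + 1) * v (S n)).
{ intros n; destruct (Nat.Even_or_Odd n) as [[j Hj]|[j Hj]].
  - replace (sum_n (fun k => (-1) ^ k * w k) n) with
      (sum_n (fun k => (-1) ^ k * w k) (2 * j + 1) + w (2 * j + 1)%nat).
    + rewrite Hodd.
      replace (E - (sum_n (fun j => w (2 * j)%nat - w (2 * j + 1)%nat) j + w (2 * j + 1)%nat))
        with ((E - sum_n (fun j => w (2 * j)%nat - w (2 * j + 1)%nat) j) - w (2 * j + 1)%nat)
        by ring.
      eapply Rle_trans; [apply Rabs_triang|]; rewrite Rabs_Ropp.
      pose proof (HE j) as H1; pose proof (Rabs_wave s tau phi (ln (INR (S (2 * j + 1))))) as H2.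
      change (Rabs (w (2 * j + 1)%nat) <= v (2 * j + 1)%nat) in H2.
      pose proof (Hvdec (2 * j + 1)%nat (2 * S j)%nat ltac:(lia)).
      replace (S n) with (2 * j + 1)%nat by lia; nra.
    + replace (2 * j + 1)%nat with (S n) by lia; rewrite sum_n_S.
      replace (S n) with (2 * j + 1)%nat by lia.
      rewrite pow_add, pow_1_even; simpl pow; eq_R; ring.
  - rewrite Hj, Hodd; apply Rle_trans with (1 := HE j).
    replace (S (2 * j + 1)) with (2 * S j)%nat by lia.
    assert (0 < v (2 * S j)%nat) by apply exp_pos; lra. }
exists E; apply is_lim_seq_spec; intros eps.
assert (Hlim : is_lim_seq (fun n => (C + 1) * v (S n)) 0).
{ replace (Finite 0) with (Rbar_mult (C + 1) 0) by (simpl; f_equal; ring).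
  apply is_lim_seq_scal_l; apply -> (is_lim_seq_incr_1 v); apply is_lim_seq_exp_ln, Hs. }
destruct (proj2 (is_lim_seq_spec _ 0) Hlim eps) as [N HN].
exists N; intros n Hn; rewrite Rabs_minus_sym.
apply Rle_lt_trans with (1 := Hall n).
specialize (HN n Hn); rewrite Rminus_0_r in HN.
apply Rle_lt_trans with (2 := HN), Rle_abs.
Qed.

Definition eta_real (s tau phi : R) : R :=
  real (Lim_seq (sum_n (fun k => (-1) ^ k * wave s tau phi (ln (INR (S k)))))).

Lemma is_lim_seq_eta_real (s tau phi : R) : 0 < s ->
  is_lim_seq (sum_n (fun k => (-1) ^ k * wave s tau phi (ln (INR (S k)))))
    (eta_real s tau phi).
Proof.
intros Hs; destruct (eta_real_converges s tau phi Hs) as [E HE].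
unfold eta_real; rewrite (is_lim_seq_unique _ _ HE); exact HE.
Qed.

Lemma eta_real_phase (s tau phi : R) : 0 < s ->
  eta_real s tau phi = cos phi * eta_real s tau 0 + sin phi * eta_real s tau (PI / 2).
Proof.
intros Hs.
assert (H : is_lim_seq (sum_n (fun k => (-1) ^ k * wave s tau phi (ln (INR (S k)))))
  (cos phi * eta_real s tau 0 + sin phi * eta_real s tau (PI / 2))).
{ apply is_lim_seq_ext with (fun n =>
    cos phi * sum_n (fun k => (-1) ^ k * wave s tau 0 (ln (INR (S k)))) n
    + sin phi * sum_n (fun k => (-1) ^ k * wave s tau (PI / 2) (ln (INR (S k)))) n).
  - intros n; rewrite <- !sum_n_scal, <- (sum_n_plus (G := R_AbelianMonoid)).
    apply sum_n_ext; intros k; generalize (ln (INR (S k))); intros x.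
    unfold wave, plus; simpl; eq_R.
    rewrite Rplus_0_r, !cos_plus, cos_PI2, sin_PI2; ring.
  - apply is_lim_seq_plus'; apply (is_lim_seq_scal_l _ _ (Finite _)), is_lim_seq_eta_real, Hs. }
unfold eta_real at 1; rewrite (is_lim_seq_unique _ _ H); reflexivity.
Qed.

(** The block sums converge to (1 - 2^(-s)) eta in phase notation: the rotation 2^(-i tau) shows as
    the shift of the phase by tau ln 2. *)
Lemma is_lim_seq_block_wave (s tau phi : R) : 0 < s ->
  is_lim_seq (sum_n (block (fun k => wave s tau phi (ln (INR k)))))
    (eta_real s tau phi - exp (- s * ln 2) * eta_real s tau (phi + tau * ln 2)).
Proof.
intros Hs.
apply is_lim_seq_ext with (fun M =>
  sum_n (fun k => (-1) ^ k * wave s tau phi (ln (INR (S k)))) (4 * M + 3)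
  - exp (- s * ln 2) *
    sum_n (fun k => (-1) ^ k * wave s tau (phi + tau * ln 2) (ln (INR (S k)))) (2 * M + 1)).
- intros M; rewrite sum_n_block_alternate; f_equal.
  rewrite <- sum_n_scal; apply sum_n_ext; intros k; eq_R.
  rewrite mult_INR, ln_mult by (apply lt_0_INR; lia).
  replace (INR 2) with 2 by reflexivity; unfold wave.
  replace (- s * (ln 2 + ln (INR (S k)))) with (- s * ln 2 + - s * ln (INR (S k))) by ring.
  rewrite exp_plus.
  replace (tau * (ln 2 + ln (INR (S k))) + phi)
    with (tau * ln (INR (S k)) + (phi + tau * ln 2)) by ring; ring.
- apply is_lim_seq_minus'; [|apply (is_lim_seq_scal_l _ _ (Finite _))].
  + apply (is_lim_seq_subseq _ _ (fun M => (4 * M + 3)%nat)); [|apply is_lim_seq_eta_real, Hs].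
    apply eventually_subseq; intros n; lia.
  + apply (is_lim_seq_subseq _ _ (fun M => (2 * M + 1)%nat)); [|apply is_lim_seq_eta_real, Hs].
    apply eventually_subseq; intros n; lia.
Qed.

(** The inverse in [G] is meaningful only where zeta is not 0, which this guarantees for Re s >= 2.
    The first two terms leave at least 3/4 = 1/4 + 1/2, and the later ones cost at most 1/2 because
    1/(m+1)^2 <= 1/m - 1/(m+1). *)
Lemma eta_real_pos (s tau : R) : 2 <= s -> 0 < eta_real s tau 0.
Proof.
intros Hs.
set (u := fun k => (-1) ^ k * wave s tau 0 (ln (INR (S k)))).
assert (Hu : forall k, Rabs (u k) <= / INR (S k) ^ 2).
{ intros k; unfold u; rewrite Rabs_mult, pow_1_abs, Rmult_1_l.
  apply Rle_trans with (1 := Rabs_wave _ _ _ _).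
  assert (Hk : 1 <= INR (S k)) by (rewrite S_INR; pose proof (pos_INR k); lra).
  replace (/ INR (S k) ^ 2) with (exp (- 2 * ln (INR (S k)))).
  - apply exp_le_of_le.
    assert (0 <= ln (INR (S k))) by (rewrite <- ln_1; destruct Hk as [H| <-];
      [apply Rlt_le, ln_increasing; lra | lra]).
    nra.
  - replace (-2 * ln (INR (S k))) with (- (ln (INR (S k)) + ln (INR (S k)))) by ring.
    rewrite exp_Ropp, exp_plus, exp_ln by lra; f_equal; ring. }
assert (H : forall n, / 4 + / INR (S (S n)) <= sum_n u (S n)).
{ induction n as [|n IH].
  - rewrite sum_n_S, sum_O.
    replace (u O) with 1.
    + pose proof (Hu 1%nat) as H1; apply Rabs_le_between in H1; simpl INR in H1.
      replace (/ (1 + 1) ^ 2) with (/ 4) in H1 by field; simpl INR; lra.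
    + unfold u, wave; simpl INR; rewrite ln_1, !Rmult_0_r, Rplus_0_r, exp_0, cos_0; simpl; ring.
  - rewrite sum_n_S.
    pose proof (Hu (S (S n))) as H1; apply Rabs_le_between in H1.
    rewrite (S_INR (S (S n))) in *; set (m := INR (S (S n))) in *.
    assert (Hm : 1 <= m) by (unfold m; rewrite !S_INR; pose proof (pos_INR n); lra).
    assert (/ (m + 1) ^ 2 <= / m - / (m + 1)); [|lra].
    replace (/ m - / (m + 1)) with (/ (m * (m + 1))) by (field; lra).
    apply Rinv_le_contravar; nra. }
apply Rlt_le_trans with (/ 4); [lra|].
apply (is_lim_seq_le (fun _ => / 4) (fun n => sum_n u (S n)) (Finite (/ 4))
   (Finite (eta_real s tau 0))).
- intros n; assert (0 < / INR (S (S n))) by (apply Rinv_0_lt_compat, lt_0_INR; lia).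
  specialize (H n); lra.
- apply is_lim_seq_const.
- apply -> (is_lim_seq_incr_1 (sum_n u)); apply is_lim_seq_eta_real; lra.
Qed.

(** * Analytic continuation and the zeros of zeta *)

Lemma C_ext (z w : C) : Re z = Re w -> Im z = Im w -> z = w.
Proof. destruct z, w; simpl; intros -> ->; reflexivity. Qed.

Lemma eta_eq (s tau : R) : 0 < s ->
  eta (s, tau) = (eta_real s tau 0, eta_real s tau (PI / 2)).
Proof.
intros Hs.
assert (H : forall (F : nat -> R) (phi : R),
  (forall n, F (n + 1)%nat = (-1) ^ n * wave s tau phi (ln (INR (S n)))) ->
  real (Lim_seq (fun N => sum_f 1 N F)) = eta_real s tau phi).
{ intros F phi HF.
  assert (Hl : is_lim_seq (fun N => sum_f 1 N F) (eta_real s tau phi)).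
  (* At N = 0 truncated subtraction gives [sum_f 1 0] one term instead of none; shifting the
     sequence by one discards that value. *)
  { apply is_lim_seq_incr_1.
    apply is_lim_seq_ext with (2 := is_lim_seq_eta_real s tau phi Hs); intros n.
    rewrite sum_n_Reals; unfold sum_f; replace (S n - 1)%nat with n by lia.
    apply sum_eq; intros i _; symmetry; apply HF. }
  rewrite (is_lim_seq_unique _ _ Hl); reflexivity. }
unfold eta; f_equal.
- apply H; intros n; change (ssrnat.subn (n + 1) 1) with (n + 1 - 1)%nat.
  unfold npow_neg, wave; simpl Re; simpl Im.
  replace (n + 1 - 1)%nat with n by lia; replace (n + 1)%nat with (S n) by lia.
  now rewrite Rplus_0_r.
- apply H; intros n; change (ssrnat.subn (n + 1) 1) with (n + 1 - 1)%nat.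
  unfold npow_neg, wave; simpl Re; simpl Im.
  replace (n + 1 - 1)%nat with n by lia; replace (n + 1)%nat with (S n) by lia.
  rewrite cos_plus, cos_PI2, sin_PI2; ring.
Qed.

Lemma exp_polar_one (a b : R) : exp a * cos b = 1 -> exp a * sin b = 0 -> a = 0.
Proof.
intros Hc Hs.
pose proof (exp_pos a) as Ha.
assert (Hb : sin b = 0) by (apply Rmult_eq_reg_l with (exp a); lra).
pose proof (sin2_cos2 b) as H; unfold Rsqr in H; rewrite Hb in H.
assert (Hcb : 0 < cos b) by (apply Rmult_lt_reg_l with (exp a); lra).
assert (Hc1 : cos b = 1) by (apply Rsqr_inj; unfold Rsqr; lra).
assert (He : exp a = 1) by (rewrite Hc1 in Hc; lra).
rewrite <- (ln_exp a), He; apply ln_1.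
Qed.

Lemma one_minus_two_pow_neq_0 (s : C) : Re s <> 1 -> Cminus 1 (two_pow_1ms s) <> 0.
Proof.
intros Hs H; injection H as H1 H2; unfold Re, Im in *; simpl in H1, H2.
assert (Ha : (1 - fst s) * ln 2 = 0) by (apply exp_polar_one with (snd s * ln 2); lra).
pose proof ln_lt_2; apply Hs, (Rmult_eq_reg_r (ln 2)); lra.
Qed.

Lemma one_minus_npow_neq_0 (s : C) : Re s <> 0 -> Cminus 1 (npow_neg 2 s) <> 0.
Proof.
intros Hs H; injection H as H1 H2; unfold Re, Im in *; simpl in H1, H2.
change (1 + 1) with 2 in *.
assert (Ha : - fst s * ln 2 = 0) by (apply exp_polar_one with (snd s * ln 2); lra).
pose proof ln_lt_2; apply Hs, (Rmult_eq_reg_r (ln 2)); lra.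
Qed.

Lemma tent_transform_exists (s tau phi : R) : -1 < s ->
  exists I, is_RInt_line (fun t => tent (exp t) * wave (s + 1) tau phi t) I.
Proof.
intros Hs; destruct tent_bounded as [K [HK0 HK]].
destruct (is_RInt_line_half_dom (fun t => tent (exp t) * wave (s + 1) tau phi t) K (s + 1))
  as [I [HI _]]; try lra.
- intros x y; apply (ex_RInt_continuous (V := R_CompleteNormedModule)); intros t _.
  apply continuous_tent_wave.
- intros t Ht; rewrite tent_exp_neg by lra; ring.
- intros t _; rewrite Rabs_mult; apply Rmult_le_compat; try apply Rabs_pos;
    [apply HK | apply Rabs_wave].
- exists I; exact HI.
Qed.

Definition tent_transform (s tau phi : R) : R :=
  RInt_gen (fun t => tent (exp t) * wave (s + 1) tau phi t)
    (Rbar_locally m_infty) (Rbar_locally p_infty).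

Lemma is_tent_transform (s tau phi : R) : -1 < s ->
  is_RInt_line (fun t => tent (exp t) * wave (s + 1) tau phi t) (tent_transform s tau phi).
Proof.
intros Hs; destruct (tent_transform_exists s tau phi Hs) as [I HI].
unfold tent_transform; rewrite (is_RInt_gen_unique _ _ HI); exact HI.
Qed.

Definition tent_transform_C (s tau : R) : C :=
  (tent_transform s tau 0, tent_transform s tau (PI / 2)).

(** The block sums have two limits, one through the integral of [tent] and one through eta; equating
    them for the phases 0 and pi/2 gives the real and imaginary parts. *)
Lemma tent_transform_eta (s tau : R) : 0 < s ->
  Cmult (Cmult (s, tau) (Cplus (s, tau) 1)) (tent_transform_C s tau) =
    Cmult (Cminus 1 (npow_neg 2 (s, tau))) (eta (s, tau)).
Proof.
intros Hs.
assert (Hneg : is_RInt_line (fun t => tent (exp t) * wave (s + 1) tau (0 - PI / 2) t)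
   ((-1) * tent_transform s tau (PI / 2))).
{ apply is_RInt_line_ext with
    (fun t => (-1) * (tent (exp t) * wave (s + 1) tau (PI / 2) t)).
  - intros t; unfold wave.
    replace (tau * t + (0 - PI / 2)) with (tau * t - PI / 2) by ring.
    rewrite cos_minus, cos_plus, cos_PI2, sin_PI2; ring.
  - apply is_RInt_line_scal, is_tent_transform; lra. }
assert (H0 := is_lim_seq_tent_blocks s tau 0 _ _
  (is_tent_transform s tau 0 ltac:(lra)) Hneg).
assert (Hz : is_RInt_line (fun t => tent (exp t) * wave (s + 1) tau (PI / 2 - PI / 2) t)
   (tent_transform s tau 0)).
{ rewrite Rminus_diag; apply is_tent_transform; lra. }
assert (H1 := is_lim_seq_tent_blocks s tau (PI / 2) _ _
  (is_tent_transform s tau (PI / 2) ltac:(lra)) Hz).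
assert (E0 := is_lim_seq_unique _ _ H0).
rewrite (is_lim_seq_unique _ _ (is_lim_seq_block_wave s tau 0 Hs)) in E0.
assert (E1 := is_lim_seq_unique _ _ H1).
rewrite (is_lim_seq_unique _ _ (is_lim_seq_block_wave s tau (PI / 2) Hs)) in E1.
injection E0 as E0; injection E1 as E1.
rewrite (eta_real_phase s tau (0 + tau * ln 2) Hs) in E0.
rewrite (eta_real_phase s tau (PI / 2 + tau * ln 2) Hs) in E1.
rewrite Rplus_0_l in E0.
rewrite (Rplus_comm (PI / 2)), cos_plus, sin_plus, cos_PI2, sin_PI2 in E1.
rewrite (eta_eq s tau Hs); unfold tent_transform_C.
apply C_ext; simpl; change (1 + 1) with 2; [rewrite <- Rminus_0_r | ]; lra.
Qed.

Definition has_power_series_C (f : R -> C) (x0 r : R) : Prop :=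
  has_power_series (fun x => Re (f x)) x0 r /\ has_power_series (fun x => Im (f x)) x0 r.

Lemma has_power_series_C_mult (f g : R -> C) (x0 r : R) :
  has_power_series_C f x0 r -> has_power_series_C g x0 r ->
  has_power_series_C (fun x => Cmult (f x) (g x)) x0 r.
Proof.
intros [Hf1 Hf2] [Hg1 Hg2]; split; simpl.
- apply has_power_series_minus; apply has_power_series_mult; assumption.
- apply has_power_series_plus; apply has_power_series_mult; assumption.
Qed.

Lemma has_power_series_C_minus (f g : R -> C) (x0 r : R) :
  has_power_series_C f x0 r -> has_power_series_C g x0 r ->
  has_power_series_C (fun x => Cminus (f x) (g x)) x0 r.
Proof.
intros [Hf1 Hf2] [Hg1 Hg2]; split; simpl; apply has_power_series_minus; assumption.
Qed.

Lemma has_power_series_C_affine (a b k l x0 r : R) :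
  has_power_series_C (fun x => (a * x + b, k * x + l)) x0 r.
Proof. split; apply has_power_series_affine. Qed.

Lemma has_power_series_C_ext (f g : R -> C) (x0 r : R) :
  (forall x, f x = g x) -> has_power_series_C f x0 r -> has_power_series_C g x0 r.
Proof.
intros Hfg [H1 H2]; split;
  [apply has_power_series_ext with (2 := H1) | apply has_power_series_ext with (2 := H2)];
  intros x; now rewrite Hfg.
Qed.

Lemma has_power_series_C_exp (k : R) (z : C) (x0 r : R) :
  has_power_series_C (fun x => Cmult (RtoC (exp (k * x))) z) x0 r.
Proof.
apply has_power_series_C_mult.
- split; simpl; [apply has_power_series_exp|].
  apply has_power_series_ext with (fun x => 0 * x + 0); [intros x; ring|].
  apply has_power_series_affine.
- apply has_power_series_C_ext with (fun x => (0 * x + fst z, 0 * x + snd z)).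
  + intros x; destruct z; apply C_ext; simpl; ring.
  + apply has_power_series_C_affine.
Qed.

Lemma has_power_series_weaken (f : R -> R) (x0 r r' : R) :
  r' <= r -> has_power_series f x0 r -> has_power_series f x0 r'.
Proof. intros Hr [a Ha]; exists a; intros u Hu; apply Ha; lra. Qed.

(** The weight splits into e^(-s t) and [wave 1], and the latter decays like e^(-t) against the
    bounded [tent]; this is the abscissa -1. *)
Lemma tent_transform_has_power_series (tau phi x0 : R) : -1 < x0 ->
  has_power_series (fun s => tent_transform s tau phi) x0 (x0 - -1).
Proof.
intros Hx0; destruct tent_bounded as [K [HK0 HK]].
apply laplace_has_power_series with (fun t => tent (exp t) * wave 1 tau phi t) K;
  try assumption.
- intros x y; apply (ex_RInt_continuous (V := R_CompleteNormedModule)); intros t _.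
  apply continuous_tent_wave.
- intros t Ht; rewrite tent_exp_neg by lra; ring.
- intros t _; rewrite Rabs_mult; apply Rmult_le_compat; try apply Rabs_pos;
    [apply HK | apply Rabs_wave].
- intros s Hs; apply is_RInt_line_ext with (2 := is_tent_transform s tau phi Hs).
  intros t; unfold wave.
  replace (- (s + 1) * t) with (- s * t + - (1) * t) by ring; rewrite exp_plus; ring.
Qed.

(** * Continuation of the Laplace transform of [g] *)

Definition causal (g : R -> R) (t : R) : R := if Rlt_dec t 0 then 0 else g t.

Lemma ex_RInt_causal (g : R -> R) :
  (forall b, 0 <= b -> ex_RInt g 0 b) -> forall x y, ex_RInt (causal g) x y.
Proof.
intros Hg.
assert (H : forall b, ex_RInt (causal g) 0 b).
{ intros b; destruct (Rle_dec 0 b) as [Hb|Hb].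
  - apply ex_RInt_ext with g; [|apply Hg, Hb].
    rewrite Rmin_left by exact Hb; intros t Ht; unfold causal.
    destruct (Rlt_dec t 0); [lra | reflexivity].
  - apply ex_RInt_ext with (fun _ => 0); [|exists 0; apply is_RInt_zero].
    rewrite Rmax_left by lra; intros t Ht; unfold causal.
    destruct (Rlt_dec t 0); [reflexivity | lra]. }
intros x y; apply ex_RInt_Chasles with 0; [apply ex_RInt_swap|]; apply H.
Qed.

(** Convergence of the Laplace integral at one real point makes the damped function integrable on
    bounded intervals; multiplying by the continuous inverse of the damping recovers [g]. *)
Lemma laplace_ex_RInt (g : R -> R) (G0 : C -> C) :
  laplace_eq_on_half_plane g G0 -> forall b, 0 <= b -> ex_RInt g 0 b.
Proof.
intros [s0 Hlap] b Hb.
destruct (Hlap (s0 + 1) 0 ltac:(lra)) as [H _].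
(* The trivial predicate extracts from the limit only that the integral exists for all sufficiently
   distant endpoints. *)
destruct (H (fun _ => True) (filter_forall _ (fun _ => I))) as [Q1 Q2 HQ1 [B HB] HQ].
set (y := Rmax b B + 1).
assert (Hy : b < y /\ B < y).
{ pose proof (Rmax_l b B); pose proof (Rmax_r b B); unfold y; lra. }
destruct (HQ 0 y HQ1 (HB y (proj2 Hy))) as [z [Hz _]]; simpl in Hz.
apply ex_RInt_ext with (fun t => exp ((s0 + 1) * t) *
   (exp (- (s0 + 1) * t) * cos (0 * t) * g t)).
- intros t _; rewrite Rmult_0_l, cos_0, Rmult_1_r, <- Rmult_assoc, <- exp_plus.
  replace ((s0 + 1) * t + - (s0 + 1) * t) with 0 by ring; rewrite exp_0; eq_R; ring.
- apply ex_RInt_mult_continuous; [exact Hb| |].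
  + apply (ex_RInt_Chasles_1 (V := R_CompleteNormedModule)) with y; [lra|]; exists z; exact Hz.
  + intros t _; apply (ex_derive_continuous (V := R_NormedModule)); auto_derive; exact I.
Qed.

(** Beyond [T1] the power t^k is absorbed by e^((c - 1/2) t) at the cost of k! / (c - 1/2)^k; before
    it, [g] is bounded because it is Riemann integrable. *)
Lemma causal_exp_bound (g : R -> R) (c : R) (k : nat) (M T : R) :
  / 2 < c -> (forall b, 0 <= b -> ex_RInt g 0 b) ->
  (forall t, T <= t -> Rabs (g t) <= M * t ^ k * exp (t / 2)) ->
  exists M', 0 <= M' /\ forall t, 0 <= t -> Rabs (causal g t) <= M' * exp (c * t).
Proof.
intros Hc Hg HT.
set (T1 := Rmax 0 T).
assert (HT1 : 0 <= T1) by apply Rmax_l.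
destruct (ex_RInt_ub g 0 T1 (Hg T1 HT1)) as [K HK].
rewrite Rmin_left, Rmax_right in HK by exact HT1.
set (d := c - / 2); assert (Hd : 0 < d) by (unfold d; lra).
assert (Hdk : 0 < d ^ k) by (apply pow_lt, Hd).
set (M2 := Rabs M * (INR (fact k) / d ^ k)).
assert (HM2 : 0 <= M2).
{ apply Rmult_le_pos; [apply Rabs_pos|].
  apply Rdiv_le_0_compat; [apply pos_INR | exact Hdk]. }
exists (Rabs K + M2); split; [pose proof (Rabs_pos K); lra|].
intros t Ht; unfold causal; destruct (Rlt_dec t 0) as [H|_]; [lra|].
destruct (Rle_dec t T1) as [Htl|Htg].
- apply Rle_trans with (Rabs K).
  + apply Rle_trans with (2 := Rle_abs K); exact (HK t (conj Ht Htl)).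
  + assert (1 <= exp (c * t)) by (rewrite <- exp_0; apply exp_le_of_le; nra).
    pose proof (Rabs_pos K); nra.
- apply Rle_trans with (M2 * exp (c * t)).
  2:{ pose proof (exp_pos (c * t)); pose proof (Rabs_pos K); nra. }
  apply Rle_trans with (1 := HT t ltac:(pose proof (Rmax_r 0 T); unfold T1 in Htg; lra)).
  apply Rle_trans with (Rabs M * t ^ k * exp (t / 2)).
  { apply Rmult_le_compat_r; [apply Rlt_le, exp_pos|].
    apply Rmult_le_compat_r; [apply pow_le, Ht | apply Rle_abs]. }
  replace (c * t) with (d * t + t / 2) by (unfold d; field); rewrite exp_plus.
  unfold M2; rewrite !Rmult_assoc; apply Rmult_le_compat_l; [apply Rabs_pos|].
  rewrite <- Rmult_assoc.
  apply Rmult_le_compat_r; [apply Rlt_le, exp_pos|].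
  pose proof (pow_fact_le_exp (d * t) k ltac:(nra)) as H.
  rewrite Rpow_mult_distr in H.
  replace (t ^ k) with (INR (fact k) / d ^ k * (d ^ k * t ^ k / INR (fact k)))
    by (field; split; [apply INR_fact_neq_0 | lra]).
  apply Rmult_le_compat_l; [|exact H].
  apply Rdiv_le_0_compat; [apply pos_INR | exact Hdk].
Qed.

Lemma G_eta (s : C) : 2 <= Re s ->
  Cmult (Cmult (G s) (Cminus s 1)) (eta s) = Cminus 1 (two_pow_1ms s).
Proof.
intros Hs.
assert (H1 : Cminus s 1 <> 0).
{ intros H; injection H as H _; unfold Re in Hs; lra. }
assert (H2 : Cminus 1 (two_pow_1ms s) <> 0) by (apply one_minus_two_pow_neq_0; lra).
assert (H3 : eta s <> 0).
{ destruct s as [sg tau]; simpl in Hs; rewrite eta_eq by lra; intros H.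
  injection H as H _; pose proof (eta_real_pos sg tau Hs); lra. }
unfold G, zeta; field; repeat split; assumption.
Qed.

(** A zero of the transform would annihilate one side of the continued identity, whereas the zeros
    of (1 - 2^(1-s)) (1 - 2^(-s)) have real part 1 or 0. About the continued Laplace transform of
    [g] it suffices to know that it has a finite value at the point. *)
Lemma tent_transform_neq_0 (g : R -> R) (s tau : R) :
  laplace_eq_on_half_plane g G ->
  (exists k : nat, (k <= 2)%nat /\ exists M T : R, forall t : R, T <= t ->
        Rabs (g t) <= M * t ^ k * exp (t / 2)) ->
  / 2 < s < 1 -> tent_transform_C s tau <> 0.
Proof.
intros Hlap [k [_ [M0 [T HT]]]] Hs HL.
pose proof (laplace_ex_RInt g G Hlap) as Hg.
(* Strictly between 1/2 and [s]: the growth bound holds with rate [c], and [s] lies inside the disc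
   of radius [x0 - c]. *)
set (c := (s + / 2) / 2).
destruct (causal_exp_bound g c k M0 T) as [M [HM HgM]]; [unfold c; lra | exact Hg | exact HT|].
destruct Hlap as [s0 Hlap].
(* The ball of radius 1 about [x0] lies to the right of [s0], where the Laplace transform is known
   to be [G], and of 2, where eta does not vanish. *)
set (x0 := Rmax s0 2 + 2).
assert (Hx0 : s0 + 2 <= x0 /\ 4 <= x0).
{ pose proof (Rmax_l s0 2); pose proof (Rmax_r s0 2); unfold x0; lra. }
set (F := fun phi x => RInt_gen (fun t => exp (- x * t) * (cos (tau * t + phi) * causal g t))
    (Rbar_locally m_infty) (Rbar_locally p_infty)).
assert (Hgc := ex_RInt_causal g Hg).
assert (Hw := fun w => ex_RInt_mult_continuous_everywhere (causal g) w Hgc).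
assert (HF : forall phi x, c < x -> is_RInt_line
   (fun t => exp (- x * t) * (cos (tau * t + phi) * causal g t)) (F phi x)).
{ intros phi x Hx.
  destruct (is_RInt_line_half_dom
    (fun t => exp (- x * t) * (cos (tau * t + phi) * causal g t)) M (x - c)) as [J [HJ _]].
  - lra.
  - exact HM.
  - intros a b; apply ex_RInt_ext with
      (fun t => (exp (- x * t) * cos (tau * t + phi)) * causal g t).
    + intros t _; apply Rmult_assoc.
    + apply (Hw (fun t => exp (- x * t) * cos (tau * t + phi))); intros t.
      apply (ex_derive_continuous (V := R_NormedModule)); auto_derive; exact I.
  - intros t Ht; unfold causal; destruct (Rlt_dec t 0); [ring | lra].
  - intros t Ht; rewrite !Rabs_mult, (Rabs_right (exp _)) by (apply Rle_ge, Rlt_le, exp_pos).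
    replace (M * exp (- (x - c) * t)) with (exp (- x * t) * (1 * (M * exp (c * t)))).
    + apply Rmult_le_compat_l; [apply Rlt_le, exp_pos|].
      apply Rmult_le_compat; try apply Rabs_pos; [apply Rabs_le, COS_bound | apply HgM, Ht].
    + replace (- (x - c) * t) with (- x * t + c * t) by ring; rewrite exp_plus; ring.
  - unfold F; rewrite (is_RInt_gen_unique _ _ HJ); exact HJ. }
assert (HFps : forall phi, has_power_series (F phi) x0 (x0 - c)).
{ intros phi; apply laplace_has_power_series with
    (fun t => cos (tau * t + phi) * causal g t) M; try assumption.
  - unfold c; lra.
  - apply (Hw (fun t => cos (tau * t + phi))); intros t.
    apply (ex_derive_continuous (V := R_NormedModule)); auto_derive; exact I.
  - intros t Ht; unfold causal; destruct (Rlt_dec t 0); [ring | lra].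
  - intros t Ht; rewrite Rabs_mult, <- (Rmult_1_l (M * exp (c * t))).
    apply Rmult_le_compat; try apply Rabs_pos; [apply Rabs_le, COS_bound | apply HgM, Ht].
  - intros x Hx; apply HF, Hx. }
assert (HFG : forall x, s0 < x -> c < x -> (F 0 x, F (PI / 2) x) = G (x, tau)).
{ intros x Hx Hxc; destruct (Hlap x tau Hx) as [H1 H2].
  apply C_ext; simpl Re; simpl Im.
  - apply (is_RInt_line_unique _ _ _ (HF 0 x Hxc)).
    apply is_RInt_line_ext with (2 := is_RInt_line_half _ _ H1); intros t; unfold causal.
    destruct (Rlt_dec t 0); [ring | rewrite Rplus_0_r; ring].
  - apply (is_RInt_line_unique _ _ _ (HF (PI / 2) x Hxc)).
    apply is_RInt_line_ext with (2 := is_RInt_line_half _ _ H2); intros t; unfold causal.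
    destruct (Rlt_dec t 0); [ring | rewrite cos_plus, cos_PI2, sin_PI2; ring]. }
set (prod := fun x => Cmult (Cminus 1 (two_pow_1ms (x, tau))) (Cminus 1 (npow_neg 2 (x, tau)))).
(* Without quotients, power series for the factors suffice. Eta enters through the transform of
   [tent], which is an absolutely convergent Laplace integral and hence such a series. *)
set (Phi := fun x => Cminus
   (Cmult (Cmult (F 0 x, F (PI / 2) x) (Cminus (x, tau) 1))
     (Cmult (Cmult (x, tau) (Cplus (x, tau) 1)) (tent_transform_C x tau))) (prod x)).
assert (HPhi0 : forall u, Rabs u < 1 -> Phi (x0 + u) = 0).
{ intros u Hu; destruct (Rabs_def2 _ _ Hu) as [Hu1 Hu2].
  unfold Phi, prod; rewrite tent_transform_eta by lra.
  rewrite HFG by (unfold c; lra).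
  rewrite <- G_eta by (simpl; lra); ring. }
assert (HPhi : has_power_series_C Phi x0 (x0 - c)).
{ assert (Hone : forall z : C, has_power_series_C (fun _ => z) x0 (x0 - c)).
  { intros z; apply has_power_series_C_ext with (fun x => (0 * x + fst z, 0 * x + snd z)).
    - intros x; destruct z; apply C_ext; simpl; ring.
    - apply has_power_series_C_affine. }
  assert (Hid : forall a, has_power_series_C (fun x => Cplus (x, tau) (RtoC a)) x0 (x0 - c)).
  { intros a; apply has_power_series_C_ext with (fun x => (1 * x + a, 0 * x + tau)).
    - intros x; apply C_ext; simpl; ring.
    - apply has_power_series_C_affine. }
  unfold Phi, prod; apply has_power_series_C_minus; apply has_power_series_C_mult.
  - apply has_power_series_C_mult; [split; [exact (HFps 0) | exact (HFps (PI / 2))]|].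
    apply has_power_series_C_ext with (2 := Hid (-1)); intros x; apply C_ext; simpl; ring.
  - apply has_power_series_C_mult.
    + apply has_power_series_C_mult; [|apply Hid].
      apply has_power_series_C_ext with (2 := Hid 0); intros x; apply C_ext; simpl; ring.
    + split; apply has_power_series_weaken with (x0 - -1);
        try (apply tent_transform_has_power_series; lra); unfold c; lra.
  - apply has_power_series_C_minus; [apply Hone|].
    apply has_power_series_C_ext with (fun x => Cmult (RtoC (exp (- ln 2 * x)))
      (2 * cos (tau * ln 2), - (2 * sin (tau * ln 2)))); [|apply has_power_series_C_exp].
    intros x; unfold two_pow_1ms; simpl Re; simpl Im.
    replace ((1 - x) * ln 2) with (ln 2 + - ln 2 * x) by ring.
    rewrite exp_plus, exp_ln by lra; apply C_ext; simpl; ring.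
  - apply has_power_series_C_minus; [apply Hone|].
    apply has_power_series_C_ext with (fun x => Cmult (RtoC (exp (- ln 2 * x)))
      (cos (tau * ln 2), - sin (tau * ln 2))); [|apply has_power_series_C_exp].
    intros x; unfold npow_neg; simpl Re; simpl Im; simpl INR; change (1 + 1) with 2.
    replace (- x * ln 2) with (- ln 2 * x) by ring; apply C_ext; simpl; ring. }
assert (HPhis : Phi s = 0).
{ replace s with (x0 + (s - x0)) by ring.
  assert (Hr : Rabs (s - x0) < x0 - c) by (rewrite Rabs_left; unfold c; lra).
  destruct HPhi as [HP1 HP2]; apply C_ext.
  - apply (has_power_series_identity (fun x => Re (Phi x)) x0 (x0 - c) 1 ltac:(lra) HP1);
      [|exact Hr].
    intros u Hu; rewrite HPhi0 by exact Hu; reflexivity.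
  - apply (has_power_series_identity (fun x => Im (Phi x)) x0 (x0 - c) 1 ltac:(lra) HP2);
      [|exact Hr].
    intros u Hu; rewrite HPhi0 by exact Hu; reflexivity. }
assert (Hprod : prod s = 0).
{ unfold Phi in HPhis; rewrite HL in HPhis.
  replace (prod s) with (Copp (Cminus
   (Cmult (Cmult (F 0 s, F (PI / 2) s) (Cminus (s, tau) 1))
     (Cmult (Cmult (s, tau) (Cplus (s, tau) 1)) 0)) (prod s))) by ring.
  rewrite HPhis; ring. }
unfold prod in Hprod; revert Hprod; apply Cmult_neq_0.
- apply one_minus_two_pow_neq_0; simpl; lra.
- apply one_minus_npow_neq_0; simpl; lra.
Qed.

Theorem theorem3 (g : R -> R)
  (* g is the impulse response of G: its Laplace transform is G *)
  (Hlap : laplace_eq_on_half_plane g G)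
  (* explicit formula for g on 0 < t < ln(N+1), any integer N >= 1 *)
  (Hformula : forall (N : nat) (t : R), (1 <= N)%nat -> 0 < t ->
      t < ln (INR N + 1) -> is_series (g_term N t) (g t))
  (* growth conjecture: g(t) = O(t^k e^{t/2}) for some k in {0,1,2} *)
  (Hgrowth : exists k : nat, (k <= 2)%nat /\
      exists M T : R, forall t : R, T <= t ->
        Rabs (g t) <= M * t ^ k * exp (t / 2)) :
  RH.
Proof.
intros [s tau] Hs Hz; simpl in Hs |- *.
assert (Heta : eta (s, tau) = 0).
{ assert (HD : Cminus 1 (two_pow_1ms (s, tau)) <> 0)
    by (apply one_minus_two_pow_neq_0; simpl; lra).
  transitivity (Cmult (zeta (s, tau)) (Cminus 1 (two_pow_1ms (s, tau)))).
  - unfold zeta; field; exact HD.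
  - rewrite Hz; ring. }
destruct (Rtotal_order s (/ 2)) as [Hlt|[Heq|Hgt]]; [|exact Heq|].
(* The point 1 - s + i tau mirrors the zero s + i tau in the critical line. The functional equation
   relates it to s - i tau; vanishing in every phase covers this conjugate point too. *)
- exfalso; apply (tent_transform_neq_0 g (1 - s) tau Hlap Hgrowth); [lra|].
  assert (H0 : forall psi,
    is_lim_seq (sum_n (block (fun k => wave (1 - (1 - s)) tau psi (ln (INR k))))) 0).
  { rewrite eta_eq in Heta by lra; injection Heta as E0 E1.
    assert (E : forall psi, eta_real s tau psi = 0).
    { intros psi; rewrite eta_real_phase, E0, E1 by lra; ring. }
    intros psi; replace (1 - (1 - s)) with s by ring.
    pose proof (is_lim_seq_block_wave s tau psi ltac:(lra)) as H.
    rewrite !E, Rmult_0_r, Rminus_0_r in H; exact H. }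
  assert (HT : forall psi, tent_transform (1 - s) tau psi = 0).
  { intros psi; apply (is_RInt_line_unique _ _ _ (is_tent_transform (1 - s) tau psi ltac:(lra))).
    apply tent_transform_zero; [lra | exact H0]. }
  unfold tent_transform_C; rewrite !HT; reflexivity.
- exfalso; apply (tent_transform_neq_0 g s tau Hlap Hgrowth); [lra|].
  pose proof (tent_transform_eta s tau ltac:(lra)) as H.
  rewrite Heta, Cmult_0_r in H.
  assert (Hnz : Cmult (s, tau) (Cplus (s, tau) 1) <> 0).
  { apply Cmult_neq_0; intros Hc; injection Hc as Hc _; lra. }
  transitivity (Cmult (Cinv (Cmult (s, tau) (Cplus (s, tau) 1)))
    (Cmult (Cmult (s, tau) (Cplus (s, tau) 1)) (tent_transform_C s tau))).
  + rewrite Cmult_assoc, Cinv_l by exact Hnz; ring.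
  + rewrite H; ring.
Qed.
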